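(* Given $\theta\in(0,\pi/2)$, there exist a smooth quadratically convex closed surface $S$ in $H^3$ and an oriented line (complete geodesic) $\ell$ of $H^3$ not intersecting $S$ such that $\ell$ and $B^{3}(\ell)$ intersect at a point forming the angle $\theta$, where $B$ is the outer billiard map associated with $S$.
   Context: $H^3$ is oriented three-dimensional hyperbolic space of curvature $-1$. $\mathcal{G}_{-1}$ is the space of oriented complete geodesics (oriented lines) of $H^3$: classes $[\alpha]$ of unit speed geodesics modulo $\alpha(\cdot)\sim\alpha(\cdot+t_0)$. ''Smooth'' means $C^\infty$; a closed surface is a compact, connected, embedded surface without boundary; quadratically convex means that the shape operator is definite at every point. Outer billiard map. $\mathcal{U}\subset\mathcal{G}_{-1}$ is the set of oriented lines not intersecting $S$. For $\ell=[\alpha]\in\mathcal{U}$ there are exactly two complete totally geodesic surfaces $P_\pm$ containing $\ell$ and tangent to $S$, at points $p_\pm$. Let $q_\pm=\alpha(t_\pm)$ be the point of $\ell$ realizing the distance $d_\pm$ from $\ell$ to $p_\pm$; let $\gamma_\pm$ be the unit speed geodesic with $\gamma_\pm(0)=q_\pm$, $\gamma_\pm(d_\pm)=p_\pm$; let $W_\pm$ be the parallel vector field along $\alpha$ with $W_\pm(t_\pm)=\gamma_\pm'(0)$, the signs being chosen so that $\{W_+,W_-,\alpha'\}$ is a positively oriented frame. $B(\ell)\in\mathcal{U}$ is the oriented line whose velocity at $\gamma_+(2d_+)$ is the parallel transport of $\alpha'(t_+)$ along $\gamma_+$ from $\gamma_+(0)$ to $\gamma_+(2d_+)$. *)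

(* Defs.v *)
From HB Require Import structures.
From mathcomp Require Import all_boot all_order all_algebra.
From mathcomp Require Import all_classical all_reals all_analysis.

Set Implicit Arguments.
Unset Strict Implicit.
Unset Printing Implicit Defensive.

Import Order.TTheory GRing.Theory Num.Theory.
Import numFieldNormedType.Exports.

Local Open Scope classical_set_scope.
Local Open Scope ring_scope.

(* H^3 is the upper sheet of the hyperboloid <x, x> = -1 in Lorentz space
   R^{3,1}, with coordinate 0 timelike.  The metric of H^3 is the restriction of
   the Lorentz form to the tangent spaces, its Levi-Civita derivative is the
   tangential part of the ambient derivative, and curves and vector fields take
   their values in the ambient space. *)

Section Smooth.
Context {R : realType} {V W : normedModType R}.

(* Meant for open A: all iterated directional derivatives up to order n exist
   on A, and f is C^n there. *)
Fixpoint Ck_on (n : nat) (A : set V) (f : V -> W) : Prop :=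
  match n with
  | 0 => forall x, A x -> {for x, continuous f}
  | m.+1 => (forall x, A x -> differentiable f x) /\
            forall v : V, Ck_on m A (fun x => 'D_v f x)
  end.

Definition smooth_on (A : set V) (f : V -> W) : Prop := forall n, Ck_on n A f.

End Smooth.

Section HyperbolicSpace.
Context {R : realType}.
Local Notation E := 'rV[R]_4.

Definition lorentz (x y : E) : R :=
  - (x 0 0 * y 0 0) + \sum_(i < 3) x 0 (lift ord0 i) * y 0 (lift ord0 i).

Definition H3 : set E := [set x | lorentz x x = -1 /\ 0 < x 0 0].

Definition tangent_H3 (x : E) : set E := [set v | lorentz x v = 0].

(* The orthogonal projection of the ambient space onto T_x H^3
   (recall <x, x> = -1). *)
Definition tangential (x w : E) : E := w + lorentz w x *: x.

(* arcosh (- <x, y>) *)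
Definition hdist (x y : E) : R :=
  let c := - lorentz x y in ln (c + Num.sqrt (c ^+ 2 - 1)).

(* The orientation of H^3: at x = (1, 0, 0, 0) the coordinate frame
   (e_1, e_2, e_3) is positively oriented. *)
Definition positively_oriented (x u v w : E) : Prop :=
  0 < \det (\matrix_(i < 4) [:: x; u; v; w]`_i).

Definition hangle (u v : E) : R :=
  acos (lorentz u v / (Num.sqrt (lorentz u u) * Num.sqrt (lorentz v v))).

Definition curve := R -> E.

Definition velocity (c : curve) : curve := derive1 c.

Definition parallel_along (c W : curve) : Prop :=
  forall t, [/\ tangent_H3 (c t) (W t), derivable W t 1
              & tangential (c t) (velocity W t) = 0].

(* Unit speed, complete. *)
Definition geodesic (c : curve) : Prop :=
  [/\ forall t, H3 (c t) /\ derivable c t 1,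
      forall t, lorentz (velocity c t) (velocity c t) = 1
    & parallel_along c (velocity c)].

(* An oriented line is a class of geodesics, represented as the set of its
   members. *)
Definition line_of (a : curve) : set curve :=
  [set b | exists t0, b = fun t => a (t + t0)].

Definition oriented_lines : set (set curve) := [set line_of a | a in geodesic].

(* The set of points of an oriented line. *)
Definition line_points (L : set curve) : set E :=
  [set x | exists2 a, L a & exists t, a t = x].

Definition meet_at_angle (L L' : set curve) (theta : R) : Prop :=
  exists a b s t, [/\ L a, L' b, a s = b t
                    & hangle (velocity a s) (velocity b t) = theta].

(* Locally S is the zero set in H^3 of a smooth function that is regular
   on H^3. *)
Definition embedded_surface (S : set E) : Prop :=
  S `<=` H3 /\
  forall p, S p -> exists (U : set E) (f : E -> R^o),
    [/\ open U /\ U p,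
        smooth_on U f,
        S `&` U = [set x | [/\ H3 x, U x & f x = 0]]
      & exists2 v, tangent_H3 p v & 'D_v f p != 0].

Definition tangent_space (S : set E) (p : E) : set E :=
  [set v | exists (c : R^o -> E) (e : R),
    [/\ 0 < e /\ smooth_on (ball (0 : R^o) e) c,
        forall t, ball (0 : R^o) e t -> S (c t),
        c 0 = p
      & velocity c 0 = v]].

Definition closed_surface (S : set E) : Prop :=
  [/\ S !=set0, embedded_surface S, compact S & connected S].

Definition unit_normal_field (S U : set E) (N : E -> E) : Prop :=
  [/\ open U, smooth_on U N
    & forall x, S x -> U x ->
        [/\ tangent_H3 x (N x), lorentz (N x) (N x) = 1
          & forall v, tangent_space S x v -> lorentz (N x) v = 0]].

Definition shape_operator (N : E -> E) (p v : E) : E :=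
  - tangential p ('D_v N p).

Definition definite_on (T : set E) (A : E -> E) : Prop :=
  (forall v, T v -> v != 0 -> 0 < lorentz (A v) v) \/
  (forall v, T v -> v != 0 -> lorentz (A v) v < 0).

(* Changing the unit normal field changes at most the sign of the shape
   operator at p, so its choice does not affect definiteness. *)
Definition quadratically_convex (S : set E) : Prop :=
  forall p, S p -> exists (U : set E) (N : E -> E),
    [/\ unit_normal_field S U N, U p
      & definite_on (tangent_space S p) (shape_operator N p)].

(* Connected embedded surfaces containing every complete geodesic of H^3 that
   is tangent to them at one point. *)
Definition complete_totally_geodesic (P : set E) : Prop :=
  [/\ P !=set0, embedded_surface P, connected P
    & forall c, geodesic c -> P (c 0) -> tangent_space P (c 0) (velocity c 0) ->
        forall t, P (c t)].

Definition tangent_at (S P : set E) (p : E) : Prop :=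
  [/\ S p, P p & tangent_space S p = tangent_space P p].

(* P contains the geodesic a and is tangent to S at p; a t is the point of a
   closest to p; g is the unit speed geodesic from a t to p; W is the parallel
   field along a whose value at t is the initial velocity of g. *)
Definition tangency (S : set E) (a : curve)
    (P : set E) (p : E) (t : R) (g W : curve) : Prop :=
  [/\ complete_totally_geodesic P /\ (forall s, P (a s)),
      tangent_at S P p,
      forall s, hdist (a t) p <= hdist (a s) p,
      [/\ geodesic g, g 0 = a t & g (hdist (a t) p) = p]
    & parallel_along a W /\ W t = velocity g 0].

Definition outer_lines (S : set E) : set (set curve) :=
  [set L | oriented_lines L /\ line_points L `&` S = set0].

(* The graph of the outer billiard map: the index 1 stands for +, the index 2
   for -. *)
Definition billiard_graph (S : set E) (L L' : set curve) : Prop :=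
  outer_lines S L /\
  exists (a : curve) (P1 P2 : set E) (p1 p2 : E) (t1 t2 : R)
         (g1 g2 W1 W2 : curve),
    [/\ L a,
        tangency S a P1 p1 t1 g1 W1,
        tangency S a P2 p2 t2 g2 W2,
        forall t, positively_oriented (a t) (W1 t) (W2 t) (velocity a t)
      & exists (X b : curve),
          let d1 := hdist (a t1) p1 in
          [/\ parallel_along g1 X, X 0 = velocity a t1, geodesic b,
              b 0 = g1 (2 * d1) /\ velocity b 0 = X (2 * d1)
            & L' = line_of b]].

(* The value is the junk set0, which is not an oriented line, when L has no
   image. *)
Definition outer_billiard (S : set E) (L : set curve) : set curve :=
  xget set0 [set L' | billiard_graph S L L'].

End HyperbolicSpace.

(* Main.v *)
Require Import Defs.
From mathcomp Require Import all_boot all_order all_algebra.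
From mathcomp Require Import all_classical all_reals all_analysis.
From mathcomp Require Import ring lra.

Set Implicit Arguments.
Unset Strict Implicit.
Unset Printing Implicit Defensive.

Import Order.TTheory GRing.Theory Num.Theory.
Import numFieldNormedType.Exports.

Local Open Scope classical_set_scope.
Local Open Scope ring_scope.

(* If the plane used by the outer billiard map at the line l touches S at p,
   then the image of l is l reflected in the point p, with its orientation
   reversed, i.e. the image under -s_p, where s_p y = - y - 2 <y, p> p on the
   hyperboloid.

   Take an equilateral triangle o0 o1 o2 in a plane Pi with cosh (side) = 7,
   and let p1, p2, p3 be the midpoints of o0 o1, o1 o2, o2 o0. The product of
   the three point reflections fixes o0, and it acts on the tangent space
   there by composing the reflection in Pi with a rotation by pi + delta,
   where delta is the area of the triangle (cos delta = -7/128). A line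
   through o0 tilted with respect to the normal of Pi is therefore sent to
   another line through o0, and the tilt can be tuned to make the angle theta.
   The sides of the triangle are tangent at their midpoints to its Steiner
   inellipse, and adding a suitable mixed term and a large multiple of the
   squared height over Pi to the form of this ellipse gives a quadric Q = 0
   whose tangent plane at each p_i contains the corresponding line. Here Q is
   a multiple of L + A with L the Lorentz form and A positive definite, so S
   is the set A = 1 in H^3. Since L is nonnegative on tangent vectors of H^3,
   Q is positive definite on the tangent planes of S, which gives convexity
   and shows that each line has only the two tangent planes found. *)

(** * Smooth functions *)

Section SmoothFunctions.
Context {R : realType} {V : normedModType R}.

(** Only the germ of a function enters its first order expansion, so the differential of [f] also
    serves [g]. *)
Lemma near_eq_differentiable {W : normedModType R} (f g : V -> W) (x : V) :
  {near x, f =1 g} -> differentiable f x -> differentiable g x.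
Proof.
move=> fg df; have [dfc dfo] := (diff_locallyP x f).1 df.
have fgx : f x = g x by exact: (nbhs_singleton fg).
suff go : g \o shift x = cst (g x) + 'd f x +o_ 0 id.
  by apply/diff_locallyP; rewrite (diff_unique dfc go).
apply/eqaddoP => e e0.
have := (eqaddoP _ _ _ _).1 dfo e e0.
have fg0 : \forall h \near (0 : V), f (h + x) = g (h + x).
  by move: fg; rewrite (near_shift 0) /=; apply: filterS => h /=; rewrite subr0.
apply: filterS2 fg0 => h fgh; rewrite !fctE /= fgx.
by rewrite -fgh.
Qed.

(** Since [A] is open, agreement on [A] is agreement near each of its points and passes to
    directional derivatives. A derivative can thus be replaced by a formula valid on [A] only. *)
Lemma Ck_on_congr {W : normedModType R} n (A : set V) (f g : V -> W) :
  open A -> (forall x, A x -> f x = g x) -> Ck_on n A f -> Ck_on n A g.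
Proof.
move=> oA; have nearA x : A x -> \forall y \near x, A y by move=> Ax; apply: open_nbhs_nbhs.
elim: n f g => [|n IH] f g fg /=.
  move=> cf x Ax; rewrite /prop_for /continuous_at -(fg x Ax).
  apply: cvg_trans (cf x Ax); apply: near_eq_cvg.
  by apply: filterS (nearA x Ax) => y Ay; rewrite fg.
move=> [df Hf]; split=> [x Ax|v].
  apply: near_eq_differentiable (df x Ax).
  by apply: filterS (nearA x Ax) => y Ay; apply: fg.
apply: (IH ('D_v f)) (Hf v) => x Ax; apply: near_eq_derive.
by apply: filterS (nearA x Ax) => y Ay; apply: fg.
Qed.

Lemma Ck_on_pred {W : normedModType R} n (A : set V) (f : V -> W) :
  Ck_on n.+1 A f -> Ck_on n A f.
Proof.
elim: n f => [|n IH] f [df Hf] /=.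
  by move=> x Ax; apply: differentiable_continuous; apply: df.
by split=> // v; apply: IH; apply: Hf.
Qed.

Lemma Ck_on_cst {W : normedModType R} n (A : set V) (c : W) :
  Ck_on n A (fun=> c).
Proof.
elim: n c => [|n IH] c /=; first by move=> x _; apply: cvg_cst.
split=> [x _|v]; first exact: differentiable_cst.
rewrite (_ : 'D_v (fun=> c) = fun=> 0); first exact: IH.
by apply/funext => x; exact: (derive_cst c).
Qed.

Lemma Ck_on_add {W : normedModType R} n (A : set V) (f g : V -> W) :
  open A -> Ck_on n A f -> Ck_on n A g -> Ck_on n A (fun x => f x + g x).
Proof.
move=> oA; elim: n f g => [|n IH] f g /=.
  by move=> cf cg x Ax; apply: cvgD; [apply: cf|apply: cg].
move=> [df Hf] [dg Hg]; split=> [x Ax|v].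
  by apply: differentiableD; [apply: df|apply: dg].
apply: Ck_on_congr (IH _ _ (Hf v) (Hg v)) => // x Ax.
by rewrite deriveD //; apply: diff_derivable; [apply: df|apply: dg].
Qed.

Lemma Ck_on_scale {W : normedModType R} n (A : set V) (f : V -> R^o) (w : W) :
  open A -> Ck_on n A f -> Ck_on n A (fun x => f x *: w).
Proof.
move=> oA; elim: n f => [|n IH] f /=.
  by move=> cf x Ax; apply: cvgZr_tmp; apply: cf.
move=> [df Hf]; split=> [x Ax|v].
  by apply: differentiableZl; apply: df.
apply: Ck_on_congr (IH _ (Hf v)) => // x Ax.
by rewrite !deriveE ?diffZl //; [apply: df|apply: differentiableZl; apply: df|apply: df].
Qed.

Lemma Ck_on_mul n (A : set V) (f g : V -> R^o) :
  open A -> Ck_on n A f -> Ck_on n A g -> Ck_on n A (fun x => f x * g x : R^o).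
Proof.
move=> oA; elim: n f g => [|n IH] f g /=.
  by move=> cf cg x Ax; apply: cvgM; [apply: cf|apply: cg].
move=> F G; have [df Hf] := F; have [dg Hg] := G; split=> [x Ax|v].
  by apply: differentiableM; [apply: df|apply: dg].
have := Ck_on_add oA (IH _ _ (Ck_on_pred F) (Hg v)) (IH _ _ (Ck_on_pred G) (Hf v)).
apply: Ck_on_congr => // x Ax.
by rewrite deriveM //; apply: diff_derivable; [apply: df|apply: dg].
Qed.

(** The function 1/sqrt, in a form whose smoothness at positive arguments comes from [expR] and [ln]
    and whose positivity needs no hypothesis. *)
Definition rsqrt (x : R) : R := expR (- (ln x / 2)).

Lemma rsqrt_gt0 x : 0 < rsqrt x. Proof. exact: expR_gt0. Qed.

Lemma rsqrt_sq x : 0 < x -> rsqrt x ^+ 2 * x = 1.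
Proof.
move=> x0; rewrite -expRM_natl -{2}(@lnK _ x) ?posrE // -expRD.
by rewrite (_ : _ + _ = 0) ?expR0 //; field.
Qed.

Lemma is_derive_rsqrt (x : R) : 0 < x ->
  is_derive x 1 (rsqrt : R -> R) (- rsqrt x ^+ 3 / 2).
Proof.
move=> x0; have Hln := is_derive1_ln x0.
rewrite /rsqrt.
have H1 : is_derive x 1 (fun y : R => - (ln y / 2)) (- (x^-1 / 2)).
  have -> : (fun y : R => - (ln y / 2)) = - (2^-1 \*: (@ln R : R -> R^o)).
    by apply/funext => y; rewrite !fctE mulrC.
  by apply: is_derive_eq; rewrite /GRing.scale /= mulrC.
have := @is_derive1_comp R (@expR R) _ x _ _ (is_derive_expR _) H1.
move=> /is_derive_eq; apply; rewrite -/(rsqrt x).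
have := rsqrt_sq x0; have := lt0r_neq0 x0 => xn0 E.
rewrite exprS (_ : rsqrt x ^+ 2 = x^-1).
  by rewrite mulrN mulNr mulrA.
by rewrite -(mulr1 x^-1) -E; field.
Qed.

Lemma differentiable_rsqrt (f : V -> R^o) x : differentiable f x -> 0 < f x ->
  differentiable (fun y => rsqrt (f y) : R^o) x.
Proof.
move=> df f0; apply: (@differentiable_comp R V R^o R^o f rsqrt x) => //.
by apply/derivable1_diffP; have [] := is_derive_rsqrt f0.
Qed.

Lemma derive_rsqrt (f : V -> R^o) x v : differentiable f x -> 0 < f x ->
  'D_v (fun y => rsqrt (f y) : R^o) x = - rsqrt (f x) ^+ 3 / 2 * 'D_v f x.
Proof.
move=> df f0; have [dr Hr] := is_derive_rsqrt f0.
have dr' : differentiable (rsqrt : R^o -> R^o) (f x) by apply/derivable1_diffP.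
rewrite deriveE; last exact: differentiable_rsqrt.
rewrite (@diff_comp R V R^o R^o f rsqrt x) //= -(deriveE v df).
rewrite -[X in 'd rsqrt _ X]mulr1 -[X in 'd rsqrt _ X]/('D_v f x *: (1 : R^o)).
by rewrite linearZ /= -(deriveE (1 : R^o) dr') Hr /GRing.scale /= mulrC.
Qed.

(** The derivative of [rsqrt] is a multiple of its cube, so the derivatives of the composite are
    products of functions covered by the induction hypothesis. *)
Lemma Ck_on_rsqrt n (A : set V) (f : V -> R^o) :
  open A -> (forall x, A x -> 0 < f x) -> Ck_on n A f ->
  Ck_on n A (fun x => rsqrt (f x) : R^o).
Proof.
move=> oA f0; elim: n => [|n IH] F.
  move=> x Ax; have [dr _] := is_derive_rsqrt (f0 x Ax).
  apply: (@continuous_comp V R^o R^o f rsqrt); first exact: F.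
  by apply: differentiable_continuous; apply/derivable1_diffP.
have [df Hf] := F; split=> [x Ax|v].
  by apply: differentiable_rsqrt; [apply: df|apply: f0].
have r := IH (Ck_on_pred F).
have := Ck_on_mul oA (Ck_on_mul oA r (Ck_on_mul oA r r))
  (Ck_on_mul oA (Ck_on_cst n A (- 2^-1 : R^o)) (Hf v)).
apply: Ck_on_congr => // x Ax.
rewrite derive_rsqrt; [|exact: df|exact: f0].
by set a := rsqrt _; set b := 'D_v _ _; rewrite /GRing.scale /=; ring.
Qed.

End SmoothFunctions.

(** * Lorentz space *)

Section Coordinates.
Context {R : realType}.
Local Notation E := 'rV[R]_4.

Definition k0 : 'I_4 := ord0.
Definition k1 : 'I_4 := lift ord0 ord0.
Definition k2 : 'I_4 := lift ord0 (lift ord0 ord0).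
Definition k3 : 'I_4 := lift ord0 (lift ord0 (lift ord0 ord0)).

Lemma sum4 (F : 'I_4 -> R) : \sum_i F i = F k0 + F k1 + F k2 + F k3.
Proof. by rewrite !big_ord_recl big_ord0 addr0 !addrA. Qed.

Lemma sum4v {W : zmodType} (F : 'I_4 -> W) :
  \sum_i F i = F k0 + F k1 + F k2 + F k3.
Proof. by rewrite !big_ord_recl big_ord0 addr0 !addrA. Qed.

Lemma ord4P (P : 'I_4 -> Prop) : P k0 -> P k1 -> P k2 -> P k3 -> forall i, P i.
Proof.
move=> p0 p1 p2 p3 [[|[|[|[|//]]]] Hi].
- by rewrite (_ : Ordinal _ = k0) //; apply: val_inj.
- by rewrite (_ : Ordinal _ = k1) //; apply: val_inj.
- by rewrite (_ : Ordinal _ = k2) //; apply: val_inj.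
- by rewrite (_ : Ordinal _ = k3) //; apply: val_inj.
Qed.

Lemma row4P (x y : E) : x 0 k0 = y 0 k0 -> x 0 k1 = y 0 k1 ->
  x 0 k2 = y 0 k2 -> x 0 k3 = y 0 k3 -> x = y.
Proof. by move=> ? ? ? ?; apply/rowP; apply: ord4P. Qed.

Definition mk4 (a b c d : R) : E := \row_(j < 4) [:: a; b; c; d]`_j.

Lemma mk4E a b c d : (mk4 a b c d 0 k0 = a) * (mk4 a b c d 0 k1 = b) *
  (mk4 a b c d 0 k2 = c) * (mk4 a b c d 0 k3 = d).
Proof. by rewrite /mk4; do !split; rewrite mxE. Qed.

Lemma lorentzE (x y : E) : lorentz x y = - (x 0 k0 * y 0 k0) + x 0 k1 * y 0 k1
  + x 0 k2 * y 0 k2 + x 0 k3 * y 0 k3.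
Proof. by rewrite /lorentz !big_ord_recl big_ord0 addr0 !addrA. Qed.

(** The Lorentz form, the form [A] of the surface and their sum all have this shape, so linearity,
    derivatives and continuity are proved once. *)
Definition bil (A : 'M[R]_4) (x y : E) : R :=
  \sum_i \sum_j A i j * (x 0 i * y 0 j).

Section Bil.
Context (A : 'M[R]_4).
Local Notation B := (bil A).

Lemma bilDl x y z : B (x + y) z = B x z + B y z.
Proof.
rewrite /bil -big_split; apply: eq_bigr => i _; rewrite -big_split.
by apply: eq_bigr => j _; rewrite !mxE /=; ring.
Qed.
Lemma bilDr x y z : B z (x + y) = B z x + B z y.
Proof.
rewrite /bil -big_split; apply: eq_bigr => i _; rewrite -big_split.
by apply: eq_bigr => j _; rewrite !mxE /=; ring.
Qed.
Lemma bilZl a x y : B (a *: x) y = a * B x y.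
Proof.
rewrite /bil big_distrr; apply: eq_bigr => i _; rewrite big_distrr /=.
by apply: eq_bigr => j _; rewrite !mxE /=; ring.
Qed.
Lemma bilZr a x y : B x (a *: y) = a * B x y.
Proof.
rewrite /bil big_distrr; apply: eq_bigr => i _; rewrite big_distrr /=.
by apply: eq_bigr => j _; rewrite !mxE /=; ring.
Qed.
Lemma bilNl x y : B (- x) y = - B x y.
Proof. by rewrite -scaleN1r bilZl mulN1r. Qed.
Lemma bilNr x y : B x (- y) = - B x y.
Proof. by rewrite -scaleN1r bilZr mulN1r. Qed.
Lemma bil0l x : B 0 x = 0.
Proof. by rewrite -(scale0r 0) bilZl mul0r. Qed.
Lemma bil0r x : B x 0 = 0.
Proof. by rewrite -(scale0r 0) bilZr mul0r. Qed.

Definition bilE := (bilDl, bilDr, bilZl, bilZr, bilNl, bilNr, bil0l, bil0r).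

Lemma bilC x y : A^T = A -> B x y = B y x.
Proof.
move=> sA; rewrite /bil exchange_big; apply: eq_bigr => i _.
apply: eq_bigr => j _ /=.
by rewrite -[in LHS]sA mxE; ring.
Qed.

Lemma is_derive_coord {V : normedModType R} (f : V -> E) (x v : V) i :
  derivable f x v -> is_derive x v (fun z => f z 0 i : R^o) ('D_v f x 0 i).
Proof.
move=> Df; have Di := (derivable_mxP f x v).1 Df 0 i.
by have /matrixP/(_ 0 i) := derive_mx Df; rewrite mxE => ->; exact: derivableP.
Qed.

Lemma is_derive_bil {V : normedModType R} (f g : V -> E) (x v : V) (df dg : E) :
  is_derive x v f df -> is_derive x v g dg ->
  is_derive x v (fun z => B (f z) (g z) : R^o) (B df (g x) + B (f x) dg).
Proof.
move=> [Df <-] [Dg <-].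
have cf i := is_derive_coord i Df; have cg i := is_derive_coord i Dg.
have cij (i j : 'I_4) : is_derive x v (fun z => A i j * (f z 0 i * g z 0 j) : R^o)
   (A i j * (f x 0 i * 'D_v g x 0 j + g x 0 j * 'D_v f x 0 i)).
  exact: (is_deriveZ (A i j) (is_deriveM (cf i) (cg j))).
have H := is_derive_sum (fun i => is_derive_sum (fun j => cij i j)).
have -> : (fun z => B (f z) (g z) : R^o) = 
   \sum_(i < 4) \sum_(j < 4) (fun z => A i j * (f z 0 i * g z 0 j) : R^o).
  apply/funext => z; rewrite /bil fct_sumE; apply: eq_bigr => i _.
  by rewrite fct_sumE.
apply: is_derive_eq H _.
rewrite /bil -big_split; apply: eq_bigr => i _; rewrite -big_split.
by apply: eq_bigr => j _ /=; ring.
Qed.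

Context {V : normedModType R}.

Lemma Ck_on_coord n (U : set V) (f : V -> E) i :
  open U -> Ck_on n U f -> Ck_on n U (fun x => f x 0 i : R^o).
Proof.
move=> oU; elim: n f => [|n IH] f /=.
  move=> cf x Ux; apply: (@continuous_comp _ _ _ f (fun y : E => y 0 i)).
    exact: cf.
  exact: coord_continuous.
move=> [df Hf]; split=> [x Ux|v].
  apply: (@differentiable_comp _ _ _ R^o f (fun y : E => y 0 i)); first exact: df.
  exact: differentiable_coord.
apply: Ck_on_congr (IH _ (Hf v)) => // x Ux.
have Df : derivable f x v by apply: diff_derivable; apply: df.
by have [_ ->] := is_derive_coord i Df.
Qed.

Lemma Ck_on_sum {W : normedModType R} n (U : set V) m (f : 'I_m -> V -> W) :
  open U -> (forall i, Ck_on n U (f i)) -> Ck_on n U (fun x => \sum_i f i x).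
Proof.
move=> oU; elim: m f => [|m IH] f Hf.
  apply: Ck_on_congr (Ck_on_cst n U 0) => // x _; by rewrite big_ord0.
have := Ck_on_add oU (Hf ord0) (IH (fun i => f (lift ord0 i)) (fun i => Hf _)).
by apply: Ck_on_congr => // x _; rewrite big_ord_recl.
Qed.

Lemma Ck_on_bil n (U : set V) (f g : V -> E) : open U ->
  Ck_on n U f -> Ck_on n U g -> Ck_on n U (fun x => B (f x) (g x) : R^o).
Proof.
move=> oU Hf Hg; apply: Ck_on_sum => // i; apply: Ck_on_sum => // j.
apply: Ck_on_mul => //; first exact: Ck_on_cst.
by apply: Ck_on_mul => //; apply: Ck_on_coord.
Qed.

Lemma Ck_on_scalev n (U : set V) (f : V -> R^o) (g : V -> E) : open U ->
  Ck_on n U f -> Ck_on n U g -> Ck_on n U (fun x => f x *: g x).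
Proof.
move=> oU Hf Hg.
(* Expanding [g x] in the standard basis leaves products of scalar functions times fixed vectors. *)
have H : Ck_on n U (fun x => \sum_i (f x * g x 0 i) *: (delta_mx 0 i : E)).
  apply: Ck_on_sum => // i; apply: Ck_on_scale => //.
  by apply: Ck_on_mul => //; apply: Ck_on_coord.
apply: Ck_on_congr H => // x _; rewrite [in RHS](row_sum_delta (g x)) scaler_sumr.
by apply: eq_bigr => i _; rewrite scalerA.
Qed.

End Bil.

(** * The Lorentz form and the volume form *)

Definition lorentz_mx : 'M[R]_4 := \matrix_(i, j) (if i == j then if i == k0 then -1 else 1 else 0).

Lemma lorentz_bil : @lorentz R = bil lorentz_mx.
Proof.
apply/funext => x; apply/funext => y.
rewrite lorentzE /bil !sum4 !mxE /=; ring.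
Qed.

Lemma lorentz_mx_sym : lorentz_mx^T = lorentz_mx.
Proof. by apply/matrixP; apply: ord4P; apply: ord4P; rewrite !mxE. Qed.

Lemma lorentzC (x y : E) : lorentz x y = lorentz y x.
Proof. by rewrite lorentz_bil bilC // lorentz_mx_sym. Qed.

Lemma lorentz_delta (x : E) : (lorentz x (delta_mx 0 k0) = - x 0 k0) *
 (lorentz x (delta_mx 0 k1) = x 0 k1) * (lorentz x (delta_mx 0 k2) = x 0 k2) *
 (lorentz x (delta_mx 0 k3) = x 0 k3).
Proof. by rewrite !lorentzE !mxE /= !mulr0 !mulr1 !addr0 !oppr0 !add0r. Qed.

(* The proof is Lagrange's identity for the spatial parts of x and v. *)
Lemma tangent_posdef (x v : E) : lorentz x x = -1 -> lorentz x v = 0 ->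
  0 <= lorentz v v /\ (lorentz v v = 0 -> v = 0).
Proof.
rewrite !lorentzE => h1 h2.
set x0 := x 0 k0 in h1 h2 *; set x1 := x 0 k1 in h1 h2 *.
set x2 := x 0 k2 in h1 h2 *; set x3 := x 0 k3 in h1 h2 *.
set v0 := v 0 k0 in h2 *; set v1 := v 0 k1 in h2 *.
set v2 := v 0 k2 in h2 *; set v3 := v 0 k3 in h2 *.
set q := (X in 0 <= X).
have key : x0 ^+ 2 * q = v1 ^+ 2 + v2 ^+ 2 + v3 ^+ 2 +
   (x1 * v2 - x2 * v1) ^+ 2 + (x1 * v3 - x3 * v1) ^+ 2 + (x2 * v3 - x3 * v2) ^+ 2.
  have E1 : x0 ^+ 2 = 1 + x1 ^+ 2 + x2 ^+ 2 + x3 ^+ 2.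
    by apply/subr0_eq; rewrite -[RHS]subr0 -{2}(subrr (-1)) -{1}h1; ring.
  have E2 : x0 * v0 = x1 * v1 + x2 * v2 + x3 * v3.
    by apply/subr0_eq; rewrite -[RHS]oppr0 -h2; ring.
  rewrite /q (_ : x0 ^+ 2 * _ = - (x0 * v0) ^+ 2 + x0 ^+ 2 * (v1 ^+ 2 + v2 ^+ 2 + v3 ^+ 2)); last by ring.
  by rewrite E2 E1; ring.
have x0p : 0 < x0 ^+ 2.
  have := sqr_ge0 x1; have := sqr_ge0 x2; have := sqr_ge0 x3; nra.
split.
  by rewrite -(pmulr_rge0 _ x0p) key !addr_ge0 ?sqr_ge0.
move=> q0; move: key; rewrite -/q in q0; rewrite q0 mulr0 => key.
have ? := sqr_ge0 v1; have ? := sqr_ge0 v2; have ? := sqr_ge0 v3.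
have ? := sqr_ge0 (x1 * v2 - x2 * v1); have ? := sqr_ge0 (x1 * v3 - x3 * v1).
have ? := sqr_ge0 (x2 * v3 - x3 * v2).
have z1 : v1 = 0 by apply/eqP; rewrite -sqrf_eq0; apply/eqP; lra.
have z2 : v2 = 0 by apply/eqP; rewrite -sqrf_eq0; apply/eqP; lra.
have z3 : v3 = 0 by apply/eqP; rewrite -sqrf_eq0; apply/eqP; lra.
have z0 : v0 = 0.
  apply/eqP; rewrite -sqrf_eq0; apply/eqP.
  by move: q0; rewrite /q z1 z2 z3 => q0; lra.
by apply: row4P; rewrite !mxE.
Qed.

(** The 4 x 4 determinant written as a polynomial in the coordinates, so that [ring] applies to
    it. *)
Definition vol (x y z w : E) : R :=
  let m (i j k : 'I_4) := y 0 i * (z 0 j * w 0 k - z 0 k * w 0 j)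
    - y 0 j * (z 0 i * w 0 k - z 0 k * w 0 i)
    + y 0 k * (z 0 i * w 0 j - z 0 j * w 0 i) in
  x 0 k0 * m k1 k2 k3 - x 0 k1 * m k0 k2 k3 + x 0 k2 * m k0 k1 k3
  - x 0 k3 * m k0 k1 k2.


Lemma det_mx3 (A : 'M[R]_3) : let a i j := A (inord i) (inord j) in
  \det A = a 0%N 0%N * (a 1%N 1%N * a 2%N 2%N - a 1%N 2%N * a 2%N 1%N)
   - a 0%N 1%N * (a 1%N 0%N * a 2%N 2%N - a 1%N 2%N * a 2%N 0%N)
   + a 0%N 2%N * (a 1%N 0%N * a 2%N 1%N - a 1%N 1%N * a 2%N 0%N).
Proof.
move=> a.
have aE i j : A i j = a i j by rewrite /a !inord_val.
rewrite (expand_det_row _ ord0) !big_ord_recl big_ord0 /cofactor.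
rewrite !(expand_det_row _ ord0) !big_ord_recl !big_ord0 /cofactor.
rewrite !det_mx11 !mxE !aE /= /bump /=; ring.
Qed.

Lemma det_rows4 (x y z w : E) :
  \det (\matrix_(i < 4) [:: x; y; z; w]`_i) = vol x y z w.
Proof.
rewrite (expand_det_row _ ord0) sum4 /cofactor !det_mx3 !mxE /= /vol /bump /= !inordK //=.
(* The expansion produces the same index in syntactically different forms; naming coordinates by
   natural numbers makes them coincide. *)
have coordE (u : E) : exists X : nat -> R, forall a (i : 'I_4), u a i = X i.
  by exists (fun n => u 0 (inord n)) => a i; rewrite ord1 inord_val.
have [X xE] := coordE x; have [Y yE] := coordE y.
have [Z zE] := coordE z; have [W wE] := coordE w.
rewrite !xE !yE !zE !wE /k0 /k1 /k2 /k3 /= /bump /= !inordK //=. ring.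
Qed.

Lemma row_vol_basis (x y z w r : E) : vol x y z w != 0 ->
  exists a b c d, r = a *: x + b *: y + c *: z + d *: w.
Proof.
rewrite -det_rows4; set M := (\matrix_i _) => dM.
have uM : M \in unitmx by rewrite unitmxE unitfE.
have := mulmxKV uM r; set c := r *m invmx M => rE.
exists (c 0 k0), (c 0 k1), (c 0 k2), (c 0 k3); rewrite -[LHS]rE mulmx_sum_row sum4v.
by rewrite !rowK.
Qed.

(** Reversed Cauchy-Schwarz inequality. The part [y + lorentz x y *: x] of [y] tangent at [x] has
    squared length <x, y>^2 - 1, which is nonnegative and vanishes only if this part does. The sign
    of <x, y> comes from Cauchy-Schwarz for the spatial parts. *)
Lemma lorentz_le_N1 (x y : E) : H3 x -> H3 y ->
  1 <= - lorentz x y /\ (lorentz x y = -1 -> x = y).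
Proof.
move=> [x1 x0] [y1 y0].
have L (z : E) : lorentz z z = -1 ->
   z 0 k0 ^+ 2 = 1 + (z 0 k1 ^+ 2 + z 0 k2 ^+ 2 + z 0 k3 ^+ 2).
  by rewrite lorentzE => H; apply/subr0_eq; rewrite -[RHS]subr0 -{2}(subrr (-1)) -{1}H; ring.
have tan : lorentz x (y + lorentz x y *: x) = 0.
  by rewrite lorentz_bil !bilE -lorentz_bil x1; ring.
have [t0 t1] := tangent_posdef x1 tan.
have tt : lorentz (y + lorentz x y *: x) (y + lorentz x y *: x) = lorentz x y ^+ 2 - 1.
  rewrite {1}lorentz_bil !bilE -lorentz_bil x1 y1 (lorentzC y x); ring.
rewrite tt in t0 t1.
have neg : lorentz x y < 0.
  rewrite lorentzE.
  have a := L _ x1; have b := L _ y1.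
  set p := x 0 k0 in x0 a *; set q := y 0 k0 in y0 b *.
  set d := x 0 k1 * y 0 k1 + x 0 k2 * y 0 k2 + x 0 k3 * y 0 k3.
  set X := (X in 1 + X) in a; set Y := (X in 1 + X) in b.
  have X0 : 0 <= X by rewrite !addr_ge0 ?sqr_ge0.
  have Y0 : 0 <= Y by rewrite !addr_ge0 ?sqr_ge0.
  have dXY : d ^+ 2 <= X * Y.
    rewrite -subr_ge0 (_ : _ - _ = (x 0 k1 * y 0 k2 - x 0 k2 * y 0 k1) ^+ 2 +
      (x 0 k1 * y 0 k3 - x 0 k3 * y 0 k1) ^+ 2 + (x 0 k2 * y 0 k3 - x 0 k3 * y 0 k2) ^+ 2).
      by rewrite !addr_ge0 ?sqr_ge0.
    by rewrite /X /Y /d; ring.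
  have pq : 0 < p * q by rewrite mulr_gt0.
  suff : d < p * q by rewrite /d => ?; lra.
  have : d ^+ 2 < (p * q) ^+ 2 by rewrite exprMn a b; nra.
  move=> H; rewrite ltNge; apply/negP => H2; move: H; rewrite ltNge; apply/negP/negPn.
  by rewrite ler_pXn2r // ?nnegrE; lra.
split; first by nra.
move=> xy; have := t1 _; rewrite xy scaleN1r => /(_ _)/eqP.
by rewrite subr_eq0 => H; apply/esym/eqP/H; ring.
Qed.

End Coordinates.

(** * Geodesics and parallel fields *)

Section Hyperbolic.
Context {R : realType}.
Local Notation E := 'rV[R]_4.

Definition ch (t : R) : R := (expR t + expR (- t)) / 2.
Definition sh (t : R) : R := (expR t - expR (- t)) / 2.

Lemma ch0 : ch 0 = 1. Proof. by rewrite /ch oppr0 expR0; field. Qed.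
Lemma sh0 : sh 0 = 0. Proof. by rewrite /sh oppr0 expR0; field. Qed.

Lemma chN t : ch (- t) = ch t. Proof. by rewrite /ch opprK addrC. Qed.
Lemma shN t : sh (- t) = - sh t.
Proof. by rewrite /sh opprK -mulNr opprB. Qed.

Lemma chD s t : ch (s + t) = ch s * ch t + sh s * sh t.
Proof. by rewrite /ch /sh opprD !expRD; field. Qed.
Lemma shD s t : sh (s + t) = sh s * ch t + ch s * sh t.
Proof. by rewrite /ch /sh opprD !expRD; field. Qed.

Lemma ch2sh2 t : ch t ^+ 2 - sh t ^+ 2 = 1.
Proof. by rewrite -ch0 -(subrr t) chD chN shN; ring. Qed.

Lemma ch_gt0 t : 0 < ch t.
Proof. by rewrite divr_gt0 // addr_gt0 // expR_gt0. Qed.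

Lemma ch_ge1 t : 1 <= ch t.
Proof. by have := ch2sh2 t; have := ch_gt0 t; have := sqr_ge0 (sh t); nra. Qed.

Lemma sh_gt0 t : 0 < t -> 0 < sh t.
Proof. by move=> t0; rewrite divr_gt0 // subr_gt0 ltr_expR; lra. Qed.

Lemma is_derive_expRN (t : R) : is_derive t (1 : R) (fun s : R => expR (- s)) (- expR (- t)).
Proof.
have := @is_derive1_comp R (@expR R) -%R t _ _ (is_derive_expR _) (is_deriveNid t 1).
by move=> /is_derive_eq; apply; rewrite mulrN1.
Qed.

Lemma is_derive_ch (t : R) : is_derive t (1 : R) (ch : R -> R) (sh t).
Proof.
have := is_deriveZ (2^-1 : R) (is_deriveD (is_derive_expR t) (is_derive_expRN t)).
rewrite (_ : _ \*: _ = ch); last first.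
  by apply/funext => s; rewrite /ch !fctE /GRing.scale /= mulrC.
by move=> /is_derive_eq; apply; rewrite /sh /GRing.scale /= mulrC.
Qed.

Lemma is_derive_sh (t : R) : is_derive t (1 : R) (sh : R -> R) (ch t).
Proof.
have := is_deriveZ (2^-1 : R) (is_deriveB (is_derive_expR t) (is_derive_expRN t)).
rewrite (_ : _ \*: _ = sh); last first.
  by apply/funext => s; rewrite /sh !fctE /GRing.scale /= mulrC.
by move=> /is_derive_eq; apply; rewrite /ch /GRing.scale /= opprK mulrC.
Qed.

(** With r = sqrt (c^2 - 1) the numbers c + r and c - r are inverse to each other, so the formula in
    [hdist] is indeed arcosh. *)
Lemma ch_arcosh (c : R) : 1 <= c -> let d := ln (c + Num.sqrt (c ^+ 2 - 1)) in
  [/\ 0 <= d, ch d = c & sh d = Num.sqrt (c ^+ 2 - 1)].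
Proof.
move=> c1; set r := Num.sqrt _ => d.
have r2 : r ^+ 2 = c ^+ 2 - 1 by rewrite sqr_sqrtr //; nra.
have r0 : 0 <= r by rewrite sqrtr_ge0.
have cr : 0 < c + r by lra.
have e : expR d = c + r by rewrite /d lnK // posrE.
have eN : expR (- d) = c - r.
  by rewrite expRN e -[RHS]mulr1 -(divff (lt0r_neq0 cr)) mulrA -subr_sqr r2; field; exact: lt0r_neq0.
split; first by rewrite ln_ge0 //; lra.
  by rewrite /ch e eN; field.
by rewrite /sh e eN; field.
Qed.

Lemma sh_surj (s : R) : exists t, sh t = s.
Proof.
set r := Num.sqrt (s ^+ 2 + 1).
have r2 : r ^+ 2 = s ^+ 2 + 1 by rewrite sqr_sqrtr //; have := sqr_ge0 s; lra.
have r0 : 0 <= r by rewrite sqrtr_ge0.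
have cr : 0 < s + r by nra.
have e : expR (ln (s + r)) = s + r by rewrite lnK // posrE.
exists (ln (s + r)); rewrite /sh expRN e.
have -> : (s + r)^-1 = r - s.
  rewrite -[RHS]mulr1 -(divff (lt0r_neq0 cr)) mulrA (mulrC (r - s)) (addrC s) mulrC.
  by rewrite -subr_sqr r2; field; rewrite addrC; exact: lt0r_neq0.
by field.
Qed.

(** Hyperbolic polar coordinates on the sector a > |b|, with radius D = sqrt (a^2 - b^2). *)
Lemma polar_hyp (a b : R) : 0 < a -> b ^+ 2 < a ^+ 2 ->
  exists D t, [/\ 0 < D, a = D * ch t & b = D * sh t].
Proof.
move=> a0 ab; set D := Num.sqrt (a ^+ 2 - b ^+ 2).
have D0 : 0 < D by rewrite sqrtr_gt0; lra.
have D2 : D ^+ 2 = a ^+ 2 - b ^+ 2 by rewrite sqr_sqrtr; lra.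
have [t ht] := sh_surj (b / D); exists D, t.
have bE : b = D * sh t by rewrite ht; field; exact: lt0r_neq0.
split => //; have cs := ch2sh2 t; have c0 := ch_gt0 t.
apply/eqP; rewrite -(@eqrXn2 _ 2) //; first last.
- by rewrite mulr_ge0 // ltW.
- exact: ltW.
by rewrite exprMn (_ : ch t ^+ 2 = 1 + sh t ^+ 2) ?mulrDr ?mulr1 -?exprMn -?bE ?D2; [apply/eqP; ring|lra].
Qed.

(** * Geodesics and parallel fields as explicit curves in Lorentz space *)

Lemma velocity_is_derive (c : R -> E) (t : R) dc : is_derive t (1 : R) c dc -> velocity c t = dc.
Proof. by move=> [_ <-]; rewrite /velocity derive1E. Qed.

Lemma derivable_velocity (c : R -> E) (t : R) : derivable c t 1 -> is_derive t (1 : R) c (velocity c t).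
Proof. by move=> H; rewrite /velocity derive1E; apply: derivableP. Qed.

Lemma is_derive_scalev (f : R -> R) (x : E) (t : R) df : is_derive t (1 : R) f df ->
  is_derive t (1 : R) (fun s => f s *: x) (df *: x).
Proof.
move=> [Df <-].
have df' : differentiable f t by apply/derivable1_diffP.
have dx : differentiable (fun s => f s *: x) t by exact: differentiableZl.
apply: DeriveDef; first exact: diff_derivable.
by rewrite !deriveE // diffZl.
Qed.

Lemma derive0_cst (c : R -> E) : (forall t : R, is_derive t (1 : R) c 0) -> forall t, c t = c 0.
Proof.
move=> H t; apply/rowP => i; apply: (@is_derive_0_is_cst R (fun s => c s 0 i)) => s.
have [D Ds] := H s; have := derive_mx D; rewrite Ds => /matrixP/(_ 0 i).
rewrite !mxE => E0; apply: DeriveDef => //.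
by have /derivable_mxP := D; apply.
Qed.

(** The geodesic with initial point [x] and initial velocity [u]. Exchanging the two arguments
    differentiates it, so [hline u x] is its velocity field. *)
Definition hline (x u : E) : R -> E := fun t => ch t *: x + sh t *: u.

Lemma is_derive_hline x u (t : R) : is_derive t (1 : R) (hline x u) (hline u x t).
Proof.
have := is_deriveD (is_derive_scalev x (is_derive_ch t)) (is_derive_scalev u (is_derive_sh t)).
by move=> /is_derive_eq; apply; rewrite /hline addrC.
Qed.

Lemma velocity_hline x u : velocity (hline x u) = hline u x.
Proof. by apply/funext => t; apply/velocity_is_derive/is_derive_hline. Qed.

Lemma hline0 x u : hline x u 0 = x.
Proof. by rewrite /hline ch0 sh0 scale1r scale0r addr0. Qed.

Lemma hlineD x u s t : hline x u (s + t) = hline (hline x u t) (hline u x t) s.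
Proof.
by apply/rowP => i; rewrite /hline !mxE chD shD; ring.
Qed.

Definition frame (x u : E) := [/\ H3 x, lorentz x u = 0 & lorentz u u = 1].

Lemma lorentz_hline x u y t : lorentz (hline x u t) y = ch t * lorentz x y + sh t * lorentz u y.
Proof. by rewrite lorentz_bil !bilE. Qed.

(** The pair (x, u) undergoes a hyperbolic rotation, which preserves Lorentz products. The timelike
    coordinate stays positive because |u0| < x0 and |sh t| < ch t. *)
Lemma hline_frame x u t : frame x u -> frame (hline x u t) (hline u x t).
Proof.
move=> [[x1 x0] xu uu].
have cs := ch2sh2 t.
have aa : lorentz (hline x u t) (hline x u t) = -1.
  rewrite lorentz_hline !(lorentzC _ (hline _ _ _)) !lorentz_hline (lorentzC u) x1 xu uu.
  by apply: (@eq_trans _ _ (- (ch t ^+ 2 - sh t ^+ 2))); [ring|rewrite cs].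
split.
- split=> //; rewrite !mxE.
  have c0 := ch_gt0 t.
  have ux : u 0 k0 ^+ 2 < x 0 k0 ^+ 2.
    have pos (z : E) : lorentz z z = -1 -> 1 <= z 0 k0 ^+ 2.
      rewrite lorentzE => H; have := sqr_ge0 (z 0 k1); have := sqr_ge0 (z 0 k2).
      by have := sqr_ge0 (z 0 k3); nra.
    (* [x0 u - u0 x] is orthogonal to the timelike vector e0, hence spacelike. *)
    have e0 : lorentz (delta_mx 0 k0 : E) (delta_mx 0 k0) = -1.
      by rewrite lorentz_delta !mxE.
    have e1 : lorentz (delta_mx 0 k0 : E) (x 0 k0 *: u - u 0 k0 *: x) = 0.
      by rewrite lorentzC lorentz_delta !mxE; ring.
    have [sp _] := tangent_posdef e0 e1.
    have xx : x 0 k0 ^+ 2 - u 0 k0 ^+ 2 = lorentz (x 0 k0 *: u - u 0 k0 *: x) (x 0 k0 *: u - u 0 k0 *: x).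
      by rewrite lorentz_bil !bilE -lorentz_bil x1 uu xu (lorentzC u x) xu; ring.
    rewrite -xx in sp; rewrite lt_neqAle -subr_ge0 sp andbT.
    apply/negP => /eqP eq.
    have [_ z] := tangent_posdef e0 e1.
    have := z _; rewrite -xx eq subrr => /(_ erefl) z0.
    have : lorentz x (x 0 k0 *: u - u 0 k0 *: x) = u 0 k0.
      by rewrite lorentz_bil !bilE -lorentz_bil x1 xu; ring.
    rewrite z0 lorentz_bil bil0r => u0; move: eq; rewrite -u0 expr0n /=.
    by have := pos _ x1; nra.
  have : (sh t * u 0 k0) ^+ 2 < (ch t * x 0 k0) ^+ 2.
    have -> : (ch t * x 0 k0) ^+ 2 = (ch t ^+ 2 - sh t ^+ 2) * x 0 k0 ^+ 2 + sh t ^+ 2 * x 0 k0 ^+ 2.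
      by ring.
    rewrite cs exprMn; have := sqr_ge0 (sh t); have : 0 < x 0 k0 ^+ 2 by rewrite exprn_gt0.
    by nra.
  set a := sh t * _; set b := ch t * _ => ab.
  have b0 : 0 < b by rewrite mulr_gt0.
  by nra.
- rewrite lorentz_hline !(lorentzC _ (hline _ _ _)) !lorentz_hline (lorentzC u x) x1 xu uu.
  by ring.
- rewrite lorentz_hline !(lorentzC _ (hline _ _ _)) !lorentz_hline (lorentzC u x) x1 xu uu.
  by rewrite -[RHS]cs; ring.
Qed.

Lemma geodesic_hline x u : frame x u -> geodesic (hline x u).
Proof.
move=> fr; have F t := hline_frame t fr.
split=> [t|t|t].
- split; first by case: (F t).
  by case: (is_derive_hline x u t).
- by rewrite velocity_hline; case: (F t).
- rewrite velocity_hline; split.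
  + by case: (F t).
  + by case: (is_derive_hline u x t).
  + rewrite velocity_hline /tangential; case: (F t) => -[-> _] _ _.
    by rewrite scaleN1r subrr.
Qed.

Lemma is_derive_lorentz (f g : R -> E) (t : R) (df dg : E) :
  is_derive t (1 : R) f df -> is_derive t (1 : R) g dg ->
  is_derive t (1 : R) (fun s => lorentz (f s) (g s)) (lorentz df (g t) + lorentz (f t) dg).
Proof. by rewrite lorentz_bil; exact: is_derive_bil. Qed.

Lemma is_derive_coordv (f : R -> E) (t : R) df i : is_derive t (1 : R) f df ->
  is_derive t (1 : R) (fun s => f s 0 i : R) (df 0 i).
Proof. by move=> [Df <-]; exact: is_derive_coord. Qed.

(** Differentiating <c, c'> = 0 gives <c, c''> = -1, which turns the vanishing of the tangential
    acceleration into c'' = c. This equation is solved by noting that ch c - sh c' and ch c' - sh c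
    have derivative zero. *)
Lemma geodesic_is_hline c : geodesic c ->
  frame (c 0) (velocity c 0) /\ c = hline (c 0) (velocity c 0).
Proof.
move=> [Hc Hv Hp].
have dc (t : R) : is_derive t (1 : R) c (velocity c t) by apply: derivable_velocity; case: (Hc t).
have dv (t : R) : is_derive t (1 : R) (velocity c) (velocity (velocity c) t).
  by apply: derivable_velocity; case: (Hp t).
have tg t : lorentz (c t) (velocity c t) = 0 by case: (Hp t).
have acc t : velocity (velocity c) t = c t.
  have := is_derive_lorentz (dc t) (dv t).
  have -> : (fun s => lorentz (c s) (velocity c s)) = cst 0 by apply/funext => s.
  move=> [_]; rewrite derive_cst Hv => e.
  have [_ _] := Hp t; rewrite /tangential (lorentzC _ (c t)).
  have -> : lorentz (c t) (velocity (velocity c) t) = -1 by lra.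
  by rewrite scaleN1r => /eqP; rewrite subr_eq0 => /eqP.
split; first by split; [case: (Hc 0)|apply: tg|apply: Hv].
apply/funext => t; apply/rowP => i.
have dci (s : R) := is_derive_coordv i (dc s).
have dvi (s : R) := is_derive_coordv i (dv s).
have F' (s : R) : is_derive s (1 : R) (fun s => ch s * c s 0 i - sh s * velocity c s 0 i) 0.
  have := is_deriveB (is_deriveM (is_derive_ch s) (dci s))
    (is_deriveM (is_derive_sh s) (dvi s)).
  by move=> /is_derive_eq; apply; rewrite acc /GRing.scale /=; ring.
have G' (s : R) : is_derive s (1 : R) (fun s => ch s * velocity c s 0 i - sh s * c s 0 i) 0.
  have := is_deriveB (is_deriveM (is_derive_ch s) (dvi s))
    (is_deriveM (is_derive_sh s) (dci s)).
  by move=> /is_derive_eq; apply; rewrite acc /GRing.scale /=; ring.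
have := is_derive_0_is_cst t 0 F'; have := is_derive_0_is_cst t 0 G'.
rewrite ch0 sh0 !mul1r !mul0r !subr0 => G0 F0.
rewrite /hline !mxE -F0 -G0 -[LHS]mul1r -(ch2sh2 t); ring.
Qed.

(** The parallel equation makes W' a multiple of the position c, so <W, c'> keeps its value 0.
    Differentiating <W, c> = 0 then shows that the multiple is 0: a parallel field orthogonal to its
    line is constant in the ambient space. *)
Lemma parallel_orth_cst x u W t0 : frame x u -> parallel_along (hline x u) W ->
  lorentz (W t0) (hline u x t0) = 0 -> W = fun=> W t0.
Proof.
move=> fr PW o0.
have dW (t : R) : is_derive t (1 : R) W (velocity W t).
  by apply: derivable_velocity; case: (PW t).
have da := is_derive_hline x u; have dv := is_derive_hline u x.
have tg t : lorentz (W t) (hline x u t) = 0 by rewrite lorentzC; case: (PW t).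
have W' t : velocity W t = - lorentz (velocity W t) (hline x u t) *: hline x u t.
  have [_ _ /eqP] := PW t; rewrite /tangential addr_eq0 => /eqP e.
  by rewrite {1}e scaleNr.
have k' (t : R) : is_derive t (1 : R) (fun s => lorentz (W s) (hline u x s)) 0.
  have := is_derive_lorentz (dW t) (dv t); rewrite tg addr0 W'.
  have [_ xu _] := hline_frame t fr.
  by rewrite lorentz_bil bilZl -lorentz_bil xu mulr0.
have k0' t : lorentz (W t) (hline u x t) = 0.
  by rewrite -o0; exact: (@is_derive_0_is_cst R (fun s => lorentz (W s) (hline u x s)) t t0).
have W0 (t : R) : is_derive t (1 : R) W 0.
  apply: is_derive_eq (dW t) _; rewrite W'.
  have := is_derive_lorentz (dW t) (da t).
  have -> : (fun s => lorentz (W s) (hline x u s)) = cst 0 by apply/funext => s; rewrite tg.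
  move=> [_]; rewrite derive_cst k0' addr0 => <-; by rewrite oppr0 scale0r.
by apply/funext => t; rewrite (derive0_cst W0 t) (derive0_cst W0 t0).
Qed.

Lemma parallel_cst x u w : lorentz w x = 0 -> lorentz w u = 0 ->
  parallel_along (hline x u) (fun=> w).
Proof.
move=> wx wu t; split.
- by rewrite /tangent_H3 /= lorentz_hline !(lorentzC _ w) wx wu !mulr0 addr0.
- exact: derivable_cst.
- have -> : velocity (fun=> w : E) t = 0.
    by apply: velocity_is_derive; exact: is_derive_cst.
  by rewrite /tangential lorentz_bil bil0l scale0r addr0.
Qed.

Lemma H3_rescale (y : E) : lorentz y y < 0 -> 0 < y 0 k0 ->
  H3 (rsqrt (- lorentz y y) *: y).
Proof.
move=> yy y0; split.
  have := @rsqrt_sq R (- lorentz y y); rewrite oppr_gt0 => /(_ yy) e.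
  by rewrite [in LHS]lorentz_bil !bilE -lorentz_bil; lra.
by rewrite mxE mulr_gt0 // rsqrt_gt0.
Qed.

(** * Distances and connecting geodesics *)

Lemma lorentz_lt0 (x y : E) : H3 x -> H3 y -> lorentz x y < 0.
Proof. by move=> Hx Hy; have [? _] := lorentz_le_N1 Hx Hy; lra. Qed.

Lemma hdistE (x y : E) : H3 x -> H3 y ->
  0 <= hdist x y /\ ch (hdist x y) = - lorentz x y.
Proof.
move=> Hx Hy; have [c1 _] := lorentz_le_N1 Hx Hy.
by have [] := ch_arcosh c1.
Qed.

Lemma ch_inj_mono (s t : R) : 0 <= s -> 0 <= t -> (ch s <= ch t) = (s <= t).
Proof.
move=> s0 t0.
have mono (a b : R) : 0 <= a -> a < b -> ch a < ch b.
  move=> a0 ab; rewrite -(subrK a b) chD.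
  have := ch_ge1 (b - a); have := ch_gt0 a.
  have sb : 0 < sh (b - a) by apply: sh_gt0; rewrite subr_gt0.
  have sa : 0 <= sh a by move: a0; rewrite le_eqVlt => /orP[/eqP<-|/sh_gt0/ltW//]; rewrite sh0.
  move=> c0 c1; have := ch2sh2 (b - a).
  have c2 : 1 < ch (b - a).
    have := ch2sh2 (b - a); have := sb; nra.
  nra.
case: (leP s t) => [|ts].
  by rewrite le_eqVlt => /orP[/eqP->|/(mono _ _ s0)/ltW ->]; rewrite ?lexx.
by apply/negbTE; rewrite -ltNge; exact: mono.
Qed.

Lemma hdist_le (x y z w : E) : H3 x -> H3 y -> H3 z -> H3 w ->
  (hdist x y <= hdist z w) = (lorentz z w <= lorentz x y).
Proof.
move=> Hx Hy Hz Hw; have [a b] := hdistE Hx Hy; have [c d] := hdistE Hz Hw.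
by rewrite -ch_inj_mono // b d lerN2.
Qed.

(** The initial velocity is the component of [p] tangent at [x], divided by its length [sh d]. *)
Lemma geodesic_to (x p : E) : H3 x -> H3 p -> x != p -> let d := hdist x p in
  let v := (sh d)^-1 *: (p - ch d *: x) in
  [/\ 0 < d, frame x v & p = hline x v d].
Proof.
move=> Hx Hp xp d v; have [d0 cd] := hdistE Hx Hp.
have dp : 0 < d.
  rewrite lt_neqAle d0 andbT; apply/eqP => e; move: cd; rewrite -/d -e ch0 => h.
  have [_ E1] := lorentz_le_N1 Hx Hp; move: xp; rewrite E1 ?eqxx //.
  by rewrite -(opprK (lorentz x p)) -h.
have sd := sh_gt0 dp; have sd0 := lt0r_neq0 sd.
have [[x1 _] [p1 _]] := (Hx, Hp).
have xpE : lorentz x p = - ch d by rewrite cd opprK.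
have cs := ch2sh2 d.
split => //; last first.
  by rewrite /hline /v scalerA divff // scale1r addrC subrK.
split => //; rewrite /v lorentz_bil !bilE -lorentz_bil ?(lorentzC p x) x1 ?p1 xpE.
  by field.
apply/eqP; rewrite -(inj_eq (mulfI (mulf_neq0 sd0 sd0))); apply/eqP.
by rewrite mulr1 -[RHS]addr0 -(subrr 1) -{1}cs; field.
Qed.

End Hyperbolic.

(** * Convex surfaces cut out by a quadratic form *)

Section Smoothness4.
Context {R : realType}.
Local Notation E := 'rV[R]_4.

Lemma Ck_on_id {V : normedModType R} n (U : set V) : Ck_on n U (fun x : V => x).
Proof.
case: n => [|n] /=; first by move=> x _; exact: cvg_id.
split=> [x _|v].
  by have := is_diff_id x => -[].
rewrite (_ : 'D_v _ = fun=> v); first exact: Ck_on_cst.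
by apply/funext => x; exact: derive_id.
Qed.

Lemma is_derive_bil1 (A : 'M[R]_4) (x v : E) :
  is_derive x v (fun z : E => bil A z z : R^o) (bil A v x + bil A x v).
Proof. exact: is_derive_bil (is_derive_id x v) (is_derive_id x v). Qed.

Lemma bil_continuous (A : 'M[R]_4) {T : topologicalType} (f g : T -> E) :
  continuous f -> continuous g -> continuous (fun x => bil A (f x) (g x)).
Proof.
move=> cf cg.
have sumc m (F : 'I_m -> T -> R) : (forall i, continuous (F i)) ->
    continuous (fun x => \sum_i F i x).
  elim: m F => [|m IH] F cF x.
    under eq_fun do rewrite big_ord0; exact: cvg_cst.
  rewrite (_ : (fun y => \sum_i F i y) = (fun y => F ord0 y + \sum_(i < m) F (lift ord0 i) y)).
    apply: cvgD; first exact: cF.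
    exact: (IH (fun i => F (lift ord0 i))).
  by apply/funext => y; rewrite big_ord_recl.
have sumc' := sumc; apply: sumc => i; apply: sumc' => j x.
apply: cvgM; first exact: cvg_cst.
apply: cvgM.
  apply: (@continuous_comp _ _ _ f (fun y : E => y 0 i)); first exact: cf.
  exact: coord_continuous.
apply: (@continuous_comp _ _ _ g (fun y : E => y 0 j)); first exact: cg.
exact: coord_continuous.
Qed.

(* Differentiating <c, c> = -1 shows that the rescaled curve has velocity the
   tangential part of y'. *)
Lemma rescaled_curve (y : R^o -> E) (p dy : E) :
  smooth_on setT y -> y 0 = p -> H3 p -> is_derive (0 : R^o) (1 : R^o) y dy ->
  exists e : R, 0 < e /\ let c := fun t => rsqrt (- lorentz (y t) (y t)) *: y t in
  [/\ smooth_on (ball (0 : R^o) e) c,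
      forall t, ball (0 : R^o) e t -> H3 (c t),
      c 0 = p & velocity c 0 = tangential p dy].
Proof.
move=> sy y0 Hp dy0.
have cy : continuous y by move=> t; apply: (sy 0%N).
pose g t : R^o := - lorentz (y t) (y t).
have cg : continuous g.
  move=> t; apply: cvgN; rewrite lorentz_bil; exact: bil_continuous.
have g0 : g 0 = 1 by rewrite /g y0; case: Hp => -[->] _; rewrite opprK.
have gp : \forall t \near (0 : R^o), 0 < g t.
  have := cg 0; rewrite /prop_for /continuous_at g0 => /cvgr_gt; apply.
  exact: ltr01.
have cy0 : continuous (fun t => y t 0 k0).
  move=> t; apply: (@continuous_comp _ _ _ y (fun y : E => y 0 k0)); first exact: cy.
  exact: coord_continuous.
have yp : \forall t \near (0 : R^o), 0 < y t 0 k0.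
  have := cy0 0; rewrite /continuous_at => /cvgr_gt; apply.
  by rewrite y0; case: Hp.
have : \forall t \near (0 : R^o), 0 < g t /\ 0 < y t 0 k0 by apply: filterI.
move=> /nbhs_ballP[e /= e0 He]; exists e; split=> //= ; split.
- move=> n.
  have oB : open (ball (0 : R^o) e) by exact: ball_open.
  have syn : Ck_on n (ball (0 : R^o) e) y.
    have res m (f : R^o -> E) : Ck_on m setT f -> Ck_on m (ball (0 : R^o) e) f.
      elim: m f => [|m IH] f /=; first by move=> H x _; apply: H.
      by move=> [H1 H2]; split=> [x _|v]; [exact: H1|apply: IH].
    exact: res.
  apply: Ck_on_scalev => //; apply: Ck_on_rsqrt => //.
    by move=> t /He[].
  rewrite lorentz_bil.
  have := Ck_on_mul oB (Ck_on_cst n _ (-1 : R^o)) (Ck_on_bil lorentz_mx oB syn syn).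
  by apply: Ck_on_congr => // t _; rewrite mulN1r.
- move=> t /He[gt yt]; apply: H3_rescale => //.
  by rewrite -oppr_gt0.
- rewrite -/(g 0) g0 y0 (_ : rsqrt 1 = 1) ?scale1r //.
  by rewrite /rsqrt ln1 mul0r oppr0 expR0.
- have r1 : rsqrt (g 0) = 1 by rewrite g0 /rsqrt ln1 mul0r oppr0 expR0.
  have dg : is_derive (0 : R) (1 : R) (g : R -> R) (- (lorentz dy p + lorentz p dy)).
    have := is_deriveN (is_derive_lorentz dy0 dy0); rewrite y0.
    exact.
  have dg' : differentiable (g : R^o -> R^o) 0 by apply/derivable1_diffP; case: dg.
  have g00 : 0 < g 0 by rewrite g0.
  have dr : is_derive (0 : R) (1 : R) (fun t => rsqrt (g t)) (lorentz dy p).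
    apply: DeriveDef.
      by apply/derivable1_diffP; exact: differentiable_rsqrt.
    rewrite (derive_rsqrt (1 : R^o) dg' g00) r1; case: dg => _ ->.
    by rewrite (lorentzC p dy); field.
  apply: velocity_is_derive.
  have dc i : is_derive (0 : R) (1 : R) (fun t => (rsqrt (g t) *: y t) 0 i : R) (tangential p dy 0 i).
    have := is_deriveM dr (is_derive_coordv i dy0).
    rewrite (_ : _ * _ = fun t => (rsqrt (g t) *: y t) 0 i :> R); last first.
      by apply/funext => t; rewrite mxE.
    move=> /is_derive_eq; apply.
    by rewrite r1 /tangential !mxE /GRing.scale /= y0; ring.
  have D : derivable (fun t : R => rsqrt (g t) *: y t) (0 : R) (1 : R).
    by apply/derivable_mxP => a i; rewrite ord1; case: (dc i).
  apply: DeriveDef => //; apply/rowP => i.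
  by rewrite derive_mx // mxE; case: (dc i).
Qed.

End Smoothness4.

Section Surface.
Context {R : realType}.
Local Notation E := 'rV[R]_4.

(** The lower bound by the square of the timelike coordinate is what makes the surface bounded. *)
Definition posform (A : 'M[R]_4) :=
  [/\ A^T = A, forall x : E, x != 0 -> 0 < bil A x x
    & exists2 c, 0 < c & forall x : E, c * x 0 k0 ^+ 2 <= bil A x x].

Definition e0 : E := delta_mx 0 k0.

Definition surf (A : 'M[R]_4) : set E := [set x | H3 x /\ bil A x x = 1].

Context (A : 'M[R]_4) (posA : posform A) (A00 : bil A e0 e0 < 1).

(** On the hyperboloid the Lorentz form is -1, so A = 1 becomes the homogeneous equation Q = 0.
    Points may then be rescaled freely before they are brought back to the hyperboloid. *)
Definition Qm : 'M[R]_4 := lorentz_mx + A.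
Local Notation Q := (bil Qm).
Local Notation S := (surf A).

Lemma QE x y : Q x y = lorentz x y + bil A x y.
Proof.
rewrite lorentz_bil /bil -big_split; apply: eq_bigr => i _.
by rewrite -big_split; apply: eq_bigr => j _; rewrite mxE mulrDl.
Qed.

Lemma QC x y : Q x y = Q y x.
Proof. by apply: bilC; rewrite linearD /= lorentz_mx_sym; case: posA => ->. Qed.

Lemma surfQ x : S x -> Q x x = 0.
Proof. by move=> [[x1 _] a1]; rewrite QE x1 a1 addNr. Qed.

Lemma Qsurf x : H3 x -> Q x x = 0 -> S x.
Proof. by move=> Hx; case: (Hx) => x1 _; rewrite QE x1 => ?; split=> //; lra. Qed.

Lemma Q_tangent_gt0 (x v : E) : H3 x -> lorentz x v = 0 -> v != 0 -> 0 < Q v v.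
Proof.
move=> [x1 _] xv v0; rewrite QE.
have [l _] := tangent_posdef x1 xv.
by case: posA => _ /(_ _ v0) + _; lra.
Qed.

(** As Q p p = Q p y = 0, adding a multiple of [p] to [y] does not change Q y y. The vector [v] so
    obtained is tangent to H^3 at [p], where Q is positive definite. Hence the tangent plane at [p]
    meets the cone Q <= 0 only along [p]. *)
Lemma Q_polar_gt0 p y : S p -> Q p y = 0 -> 0 < Q y y \/ y = - lorentz y p *: p.
Proof.
move=> Sp py; have [Hp _] := Sp; have [p1 _] := Hp.
have [->|v0] := eqVneq y (- lorentz y p *: p); [right|left].
  rewrite lorentz_bil !bilE -lorentz_bil p1.
  by rewrite mulrN1 opprK.
pose v := y + lorentz y p *: p.
have vE : v != 0 by rewrite addr_eq0 -scaleNr.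
have pv : lorentz p v = 0.
  by rewrite /v lorentz_bil !bilE -lorentz_bil p1 (lorentzC y); ring.
have := Q_tangent_gt0 Hp pv vE.
by rewrite /v !bilE (QC y p) py (surfQ Sp); lra.
Qed.

(** The chord r - p has Lorentz square -2 - 2 <p, r> >= 0, so Q is positive on it; its value there
    is -2 Q p r. *)
Lemma Q_chord_lt0 p r : S p -> S r -> p != r -> Q p r < 0.
Proof.
move=> Sp Sr pr; have [Hp _] := Sp; have [Hr _] := Sr.
have [l1 l2] := lorentz_le_N1 Hp Hr.
have rp0 : r - p != 0 by rewrite subr_eq0 eq_sym.
have : 0 < Q (r - p) (r - p).
  rewrite QE; have [_ /(_ _ rp0) a _] := posA.
  have [[p1 _] [r1 _]] := (Hp, Hr).
  suff : 0 <= lorentz (r - p) (r - p) by lra.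
  by rewrite lorentz_bil !bilE -lorentz_bil p1 r1 (lorentzC r p); lra.
by rewrite !bilE (surfQ Sp) (surfQ Sr) (QC r p); lra.
Qed.

Lemma H3_e0 : H3 e0.
Proof. by split; rewrite ?lorentz_delta !mxE //=. Qed.

Lemma Qe0 : Q e0 e0 < 0.
Proof. have [l _] := H3_e0; by rewrite QE l; have := A00; lra. Qed.

(** The point [e0] lies strictly inside the surface, so no tangent plane passes through it. *)
Lemma Qpe0 p : S p -> Q p e0 != 0.
Proof.
move=> Sp; apply/eqP => e; have := Qe0.
case: (Q_polar_gt0 Sp e) => [|->]; first lra.
by rewrite !bilE (surfQ Sp) !mulr0 ltxx.
Qed.

(** Half the gradient of [Q x x] with respect to the Lorentz form, whence the minus sign in the
    timelike coordinate; on the surface it is a normal vector. *)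
Definition Qgrad (x : E) : E :=
  - Q x (delta_mx 0 k0) *: delta_mx 0 k0 + Q x (delta_mx 0 k1) *: delta_mx 0 k1
  + Q x (delta_mx 0 k2) *: delta_mx 0 k2 + Q x (delta_mx 0 k3) *: delta_mx 0 k3.

Lemma lorentz_Qgrad x y : lorentz (Qgrad x) y = Q x y.
Proof.
rewrite [in RHS](row_sum_delta y) sum4v !bilE lorentzE /Qgrad !mxE /=; ring.
Qed.

(** The gradient is tangent to H^3 at [p] because Q p p = 0, so its square is positive unless it
    vanishes; its product with [e0] excludes that. *)
Lemma Qgrad_gt0 p : S p -> 0 < lorentz (Qgrad p) (Qgrad p).
Proof.
move=> Sp; have [[p1 _] _] := Sp.
have g0 : lorentz p (Qgrad p) = 0 by rewrite lorentzC lorentz_Qgrad surfQ.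
have [t0 t1] := tangent_posdef p1 g0.
rewrite lt_neqAle t0 andbT; apply/eqP => /esym/t1 G0.
by have := Qpe0 Sp; rewrite -lorentz_Qgrad G0 lorentz_bil bil0l eqxx.
Qed.

Lemma Ck_on_Qgrad n (U : set E) : open U -> Ck_on n U Qgrad.
Proof.
move=> oU.
have H (a : R) j : Ck_on n U (fun x => (a * Q x (delta_mx 0 j)) *: (delta_mx 0 j : E)).
  apply: Ck_on_scale => //; apply: Ck_on_mul => //; first exact: Ck_on_cst.
  by apply: Ck_on_bil => //; [exact: Ck_on_id|exact: Ck_on_cst].
have := Ck_on_add oU (Ck_on_add oU (Ck_on_add oU (H (-1) k0) (H 1 k1)) (H 1 k2)) (H 1 k3).
by apply: Ck_on_congr => // x _; rewrite /Qgrad !mul1r mulN1r.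
Qed.

Lemma smooth_bil (B : 'M[R]_4) (U : set E) : open U ->
  smooth_on U (fun x => bil B x x : R^o).
Proof. by move=> oU n; apply: Ck_on_bil => //; apply: Ck_on_id. Qed.

Lemma surf_embedded : embedded_surface S.
Proof.
split=> [x []//|p Sp]; exists setT, (fun x => Q x x : R^o); split.
- by split=> //; exact: openT.
- by apply: smooth_bil; exact: openT.
- rewrite setIT; apply/seteqP; split=> x /=.
    by move=> Sx; split=> //; [case: Sx|exact: surfQ].
  by move=> [Hx _ Qx]; exact: Qsurf.
- exists (Qgrad p).
    by rewrite /tangent_H3 /= lorentzC lorentz_Qgrad surfQ.
  have [_ ->] := is_derive_bil1 Qm p (Qgrad p).
  rewrite (QC (Qgrad p)) -mulr2n -lorentz_Qgrad mulrn_eq0 /=.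
  exact/lt0r_neq0/Qgrad_gt0.
Qed.

(* Both equations of the surface are constant along a curve in it. *)
Lemma surf_tangent_sub p v : S p -> tangent_space S p v ->
  lorentz p v = 0 /\ Q p v = 0.
Proof.
move=> Sp [c [e [[e_gt0 sc] Sc c0 <-]]].
have b0 : ball (0 : R^o) e 0 by exact: ballxx.
have dc : is_derive (0 : R) (1 : R) c (velocity c 0).
  apply: derivable_velocity; apply: diff_derivable.
  by have [] := sc 1%N => /(_ _ b0).
have near0 : \forall t \near (0 : R^o), S (c t).
  by apply/nbhs_ballP; exists e => //= t /Sc.
have cst0 (B : 'M[R]_4) (k : R) : (forall x, S x -> bil B x x = k) -> 
   bil B (velocity c 0) p + bil B p (velocity c 0) = 0.
  move=> Bk; have H := is_derive_bil B dc dc; rewrite c0 in H.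
  have nk : \forall t \near (0 : R), bil B (c t) (c t) = cst k t.
    by apply: filterS near0 => t /Bk.
  have [_ <-] := near_eq_is_derive nk H.
  exact: derive_cst.
have l := cst0 lorentz_mx (-1); have q := cst0 Qm 0.
rewrite -lorentz_bil in l; split.
- have := l _; rewrite (lorentzC _ p) => /(_ _).
  suff H : forall x, S x -> lorentz x x = -1 by move=> /(_ H); lra.
  by move=> x [[]].
- by have := q surfQ; rewrite (QC _ p); lra.
Qed.

(** A curve with velocity [v] is obtained from the straight line p + t v by projecting it to the
    quadric along an isotropic vector and rescaling it to the hyperboloid. *)
Lemma surf_tangent_sup p v : S p -> lorentz p v = 0 -> Q p v = 0 ->
  tangent_space S p v.
Proof.
move=> Sp pv qv; have [Hp _] := Sp; have [p1 _] := Hp.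
(* The vector [e0], scaled and corrected by a multiple of [p], becomes a second isotropic vector. *)
have [p' pp' p'p'] : exists2 p', Q p p' = 1 & Q p' p' = 0.
  pose a := (Q p e0)^-1.
  have ap : a * Q p e0 = 1 by rewrite /a mulVf // Qpe0.
  exists (a *: e0 - (a ^+ 2 * Q e0 e0 / 2) *: p); rewrite !bilE (surfQ Sp).
    by rewrite ap; ring.
  rewrite (QC e0 p).
  apply: (@eq_trans _ _ ((1 - a * Q p e0) * (a ^+ 2 * Q e0 e0))); first by field.
  by rewrite ap subrr mul0r.
pose z (t : R) : E := p + t *: v.
(* Up to the factor [Q (z t) p'], this is the point where the line through [z t] in direction [p']
   meets Q = 0; clearing the denominator keeps it polynomial in [t]. *)
pose y (t : R^o) : E := Q (z t) p' *: z t - (Q (z t) (z t) / 2) *: p'.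
have inv w : Q (Q w p' *: w - (Q w w / 2) *: p') (Q w p' *: w - (Q w w / 2) *: p') = 0.
  by rewrite !bilE p'p' (QC p' w); field.
have yy t : Q (y t) (y t) = 0 by exact: inv.
have sy : smooth_on setT y.
  move=> n; have oT := @openT R^o.
  have Kz : Ck_on n (setT : set R^o) z.
    by apply: Ck_on_add => //; [exact: Ck_on_cst|apply: Ck_on_scale => //; exact: Ck_on_id].
  have H1 : Ck_on n (setT : set R^o) (fun t => Q (z t) p' *: z t).
    by apply: Ck_on_scalev => //; apply: Ck_on_bil => //; exact: Ck_on_cst.
  have H2 : Ck_on n (setT : set R^o) (fun t => (- 2^-1 * Q (z t) (z t)) *: p').
    apply: Ck_on_scale => //; apply: Ck_on_mul => //; first exact: Ck_on_cst.
    exact: Ck_on_bil.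
  have := Ck_on_add oT H1 H2; apply: Ck_on_congr => // t _.
  by rewrite /y -scaleNr mulNr mulrC.
have y0 : y 0 = p.
  by rewrite /y /z scale0r addr0 pp' (surfQ Sp) mul0r scale0r subr0 scale1r.
(* The first order coefficient is [v] plus a multiple of [p]; the rescaling removes this
   multiple. *)
have yE : y = (fun t : R^o => p + t *: (v + Q v p' *: p) + t ^+ 2 *: (Q v p' *: v - (Q v v / 2) *: p')).
  apply/funext => t; rewrite /y /z !bilE pp' (surfQ Sp) (QC v p) qv.
  by apply/rowP => i; rewrite !mxE; field.
have dy : is_derive (0 : R^o) (1 : R^o) y (v + Q v p' *: p).
  rewrite yE.
  have d1 := is_derive_scalev (v + Q v p' *: p) (is_derive_id (0 : R) (1 : R)).
  have d2 := is_derive_scalev (Q v p' *: v - (Q v v / 2) *: p') (is_deriveX 2 (is_derive_id (0 : R) (1 : R))).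
  have := is_deriveD (is_deriveD (is_derive_cst p (0 : R) (1 : R)) d1) d2.
  move=> /is_derive_eq; apply.
  by apply/rowP => i; rewrite !mxE /GRing.scale /=; ring.
have [e [e_gt0 /= [sc Hc c0 vc]]] := rescaled_curve sy y0 Hp dy.
exists (fun t => rsqrt (- lorentz (y t) (y t)) *: y t), e; split=> //.
  move=> t /Hc Ht; apply: Qsurf => //.
  by rewrite bilZl bilZr yy !mulr0.
rewrite vc /tangential lorentz_bil bilDl bilZl -lorentz_bil p1 (lorentzC v) pv.
by apply/rowP => i; rewrite !mxE; ring.
Qed.

(** For the normalised gradient N, <N x, v> is [rsqrt (g x)] times Q x v. Since Q p v = 0, the
    derivative of the normalising factor drops out, and <D_v N, v> is a positive multiple of Q v
    v. *)
Lemma surf_convex : quadratically_convex S.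
Proof.
move=> p Sp.
pose g (x : E) : R^o := lorentz (Qgrad x) (Qgrad x).
pose U : set E := [set x | 0 < g x].
pose N (x : E) : E := rsqrt (g x) *: Qgrad x.
have KG n (V : set E) : open V -> Ck_on n V g.
  by move=> oV; rewrite /g lorentz_bil; apply: Ck_on_bil => //; exact: Ck_on_Qgrad.
have oU : open U.
  apply: (@open_comp _ _ g [set r : R^o | 0 < r]); last exact: open_gt.
  by move=> x _; exact: (KG 0%N setT openT x I).
have SU x : S x -> U x by exact: Qgrad_gt0.
have sN : smooth_on U N.
  move=> n; apply: Ck_on_scalev => //; last exact: Ck_on_Qgrad.
  by apply: Ck_on_rsqrt => //; exact: KG.
exists U, N; split; [|exact: SU|].
  split=> // x Sx Ux; split.
  - rewrite /tangent_H3 /= /N lorentz_bil bilZr -lorentz_bil lorentzC lorentz_Qgrad.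
    by rewrite surfQ // mulr0.
  - rewrite /N lorentz_bil bilZl bilZr -lorentz_bil -/(g x) mulrA -expr2.
    exact: (rsqrt_sq Ux).
  - move=> v /(surf_tangent_sub Sx)[_ qv].
    by rewrite /N lorentz_bil bilZl -lorentz_bil lorentz_Qgrad qv mulr0.
(* The minus sign in the shape operator makes it negative definite for this normal. *)
right=> v /(surf_tangent_sub Sp)[pv qv] v0.
have dN : derivable N p v.
  by apply: diff_derivable; have [] := sN 1%N => /(_ _ (SU _ Sp)).
have dr : derivable (fun x => rsqrt (g x) : R^o) p v.
  apply: diff_derivable; apply: differentiable_rsqrt; last exact: SU.
  by have [] := KG 1%N setT openT => /(_ _ I).
have H1 := is_derive_bil lorentz_mx (derivableP dN) (is_derive_cst v p v).
have H2 : is_derive p v (fun x => bil lorentz_mx (N x) v : R^o) (rsqrt (g p) * Q v v).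
  have := is_deriveM (derivableP dr) (is_derive_bil Qm (is_derive_id p v) (is_derive_cst v p v)).
  rewrite (_ : _ * _ = (fun x => bil lorentz_mx (N x) v : R^o)); last first.
    by apply/funext => x; rewrite /N bilZl -lorentz_bil lorentz_Qgrad.
  move=> /is_derive_eq; apply.
  by rewrite qv bil0r /= addr0 /GRing.scale /= mul0r addr0.
have e : lorentz ('D_v N p) v = rsqrt (g p) * Q v v.
  have [_ h1] := H1; have [_ h2] := H2; rewrite -h2 h1 bil0r addr0.
  by rewrite lorentz_bil.
rewrite /shape_operator /tangential lorentz_bil !bilE -lorentz_bil pv mulr0 addr0 e.
rewrite oppr_lt0 mulr_gt0 ?rsqrt_gt0 //.
have [Hp _] := Sp; exact: Q_tangent_gt0 Hp pv v0.
Qed.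

(** The equation A = 1 bounds the timelike coordinate, and the hyperboloid equation then bounds the
    others. *)
Lemma surf_compact : compact S.
Proof.
have [_ _ [c c0 Hc]] := posA.
have bnd x i : S x -> `|x 0 i| <= c^-1 + 1.
  move=> [[x1 _] Ax]; have := Hc x; rewrite Ax => x0.
  have x0' : x 0 k0 ^+ 2 <= c^-1.
    by rewrite -(ler_pM2l c0) divff // lt0r_neq0.
  suff : x 0 i ^+ 2 <= c^-1.
    move=> xi; have ci : 0 < c^-1 by rewrite invr_gt0.
    rewrite -(@ler_pXn2r _ 2) // ?nnegrE ?addr_ge0 ?ltW //.
    by rewrite real_normK ?num_real //; nra.
  move: x1; rewrite lorentzE.
  have := sqr_ge0 (x 0 k1); have := sqr_ge0 (x 0 k2); have := sqr_ge0 (x 0 k3).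
  move: i; apply: ord4P => //; nra.
apply: bounded_closed_compact.
  exists (c^-1 + 1); split; first exact: num_real.
  move=> M cM x Sx /=.
  have M0 : 0 <= M by apply: ltW; apply: lt_trans cM; rewrite addr_gt0 ?invr_gt0.
  rewrite /Num.Def.normr/= mx_normrE (bigmax_le _ M0) //= => -[a i] _ /=.
  by rewrite ord1; apply: ltW; apply: le_lt_trans cM; exact: bnd.
(* The timelike coordinate never vanishes on the hyperboloid, so its strict positivity may be
   relaxed to a closed condition. *)
have -> : S = (fun x : E => lorentz x x) @^-1` [set -1] `&`
   ((fun x : E => bil A x x) @^-1` [set 1] `&` (fun x : E => x 0 k0) @^-1` [set r | 0 <= r]).
  apply/seteqP; split=> x /=; first by move=> [[? ?] ?]; do !split=> //; exact: ltW.
  move=> [x1 [a1 x0]]; split=> //; split=> //; rewrite lt_neqAle x0 andbT.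
  apply/eqP => e; move: x1; rewrite lorentzE -e.
  have := sqr_ge0 (x 0 k1); have := sqr_ge0 (x 0 k2); have := sqr_ge0 (x 0 k3).
  nra.
have ci : continuous (fun x : E => x) by move=> x; exact: cvg_id.
have c1 (r : R) : closed [set r].
  exact/accessible_closed_set1/hausdorff_accessible/Rhausdorff.
apply: closedI.
  apply: closed_comp => [x _|]; last exact: c1.
  by rewrite lorentz_bil; exact: bil_continuous.
apply: closedI.
  apply: closed_comp => [x _|]; last exact: c1.
  exact: bil_continuous.
apply: closed_comp => [x _|]; first exact: coord_continuous.
exact: closed_ge.
Qed.

(* [e0 + rayroot w *: w] is the point where the ray from e0 in direction w
   leaves the cone [Q < 0]. *)
Definition rayroot (w : E) : R :=
  (Num.sqrt (Q e0 w ^+ 2 - Q e0 e0 * Q w w) - Q e0 w) / Q w w.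

Definition rayend (w : E) : E :=
  let y := e0 + rayroot w *: w in rsqrt (- lorentz y y) *: y.

Lemma direction_gt0 (w : E) : w 0 k0 = 0 -> w != 0 -> 0 < Q w w.
Proof.
move=> w0 wn; apply: (Q_tangent_gt0 H3_e0) => //.
by rewrite lorentzC lorentz_delta w0 oppr0.
Qed.

Lemma rayroot_eq (w : E) : w 0 k0 = 0 -> w != 0 ->
  Q (e0 + rayroot w *: w) (e0 + rayroot w *: w) = 0.
Proof.
move=> w0 wn; have qw := direction_gt0 w0 wn; have qn := lt0r_neq0 qw.
rewrite bilDl !bilDr bilZl !bilZr bilZl (QC w e0) /rayroot.
have q0 := Qe0; set d := Num.sqrt _.
have d2 : d ^+ 2 = Q e0 w ^+ 2 - Q e0 e0 * Q w w.
  by rewrite sqr_sqrtr //; have := sqr_ge0 (Q e0 w); nra.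
rewrite (_ : _ + _ = (d ^+ 2 - (Q e0 w ^+ 2 - Q e0 e0 * Q w w)) / Q w w); last by field.
by rewrite d2 subrr mul0r.
Qed.

Lemma rayend_surf (w : E) : w 0 k0 = 0 -> w != 0 -> S (rayend w).
Proof.
move=> w0 wn; have q := rayroot_eq w0 wn.
rewrite /rayend; set y := e0 + _ in q *.
have y0 : y 0 k0 = 1 by rewrite /y !mxE w0 /= mulr0 addr0.
have yn : y != 0 by apply/eqP => /rowP/(_ k0); rewrite y0 mxE => /eqP; rewrite oner_eq0.
have ly : lorentz y y < 0.
  by move: q; rewrite QE; case: posA => _ /(_ _ yn); lra.
apply: Qsurf; first by apply: H3_rescale; rewrite ?y0.
by rewrite bilZl bilZr q !mulr0.
Qed.

(** For w = x / x0 - e0 the vector e0 + w is proportional to [x], so the ray leaves the cone at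
    parameter 1. *)
Lemma surf_rayend x : S x ->
  exists w : E, [/\ w 0 k0 = 0, w != 0 & rayend w = x].
Proof.
move=> Sx; have [[x1 x0] _] := Sx.
pose w := (x 0 k0)^-1 *: x - e0; have xn := lt0r_neq0 x0.
have w0 : w 0 k0 = 0 by rewrite !mxE /= mulVf // subrr.
have ew : e0 + w = (x 0 k0)^-1 *: x by rewrite /w addrC subrK.
have qe : Q (e0 + w) (e0 + w) = 0 by rewrite ew bilZl bilZr surfQ // !mulr0.
have wn : w != 0.
  by apply/eqP => e; move: qe; rewrite e addr0; have := Qe0; lra.
clearbody w; exists w; split=> //.
have qw := direction_gt0 w0 wn.
have r1 : rayroot w = 1.
  rewrite /rayroot; rewrite bilDl !bilDr (QC w) in qe.
  (* Q (e0 + w) (e0 + w) = 0 makes the discriminant a square, and Q e0 e0 < 0 gives the sign of its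
     root. *)
  rewrite (_ : Q e0 w ^+ 2 - _ = (Q e0 w + Q w w) ^+ 2).
    rewrite sqrtr_sqr ger0_norm; first by field; exact: lt0r_neq0.
    by have := Qe0; nra.
  have -> : Q e0 e0 = - (Q e0 w + (Q e0 w + Q w w)) by lra.
  by ring.
rewrite /rayend r1 scale1r ew lorentz_bil bilZl bilZr -lorentz_bil x1.
rewrite scalerA (_ : rsqrt _ = x 0 k0) ?divff ?scale1r //.
set a := - _; have aE : a = (x 0 k0) ^- 2 by rewrite /a; field.
have a0 : 0 < a by rewrite aE invr_gt0 exprn_gt0.
have h := rsqrt_sq a0; have r0 := rsqrt_gt0 a.
apply/eqP; rewrite -(@eqrXn2 _ 2) ?(ltW r0) ?(ltW x0) //.
by rewrite -[X in X == _](mulfK (lt0r_neq0 a0)) h mul1r aE invrK.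
Qed.

Lemma rayend_continuous (g : R -> E) : continuous g ->
  (forall t, g t 0 k0 = 0) -> (forall t, g t != 0) ->
  continuous (rayend \o g).
Proof.
move=> cg g0 gn.
have c0 : continuous (fun _ : R => e0) by move=> t; exact: cvg_cst.
have q0g := bil_continuous (A := Qm) c0 cg; have qgg := bil_continuous (A := Qm) cg cg.
have rr : continuous (rayroot \o g).
  move=> t; apply: cvgM; last first.
    apply: cvgV; last exact: qgg.
    exact/lt0r_neq0/direction_gt0.
  apply: cvgB; last exact: q0g.
  apply: (@continuous_comp _ _ _
    (fun t => Q e0 (g t) ^+ 2 - Q e0 e0 * Q (g t) (g t)) Num.sqrt); last exact: sqrt_continuous.
  apply: cvgB; first by apply: cvgM; exact: q0g.
  by apply: cvgM; [exact: cvg_cst|exact: qgg].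
pose y t := e0 + rayroot (g t) *: g t.
have cy : continuous y.
  move=> t; apply: cvgD; first exact: cvg_cst.
  by apply: cvgZ; [exact: rr|exact: cg].
have ly : continuous (fun t => - lorentz (y t) (y t)).
  by move=> t; apply: cvgN; rewrite lorentz_bil; exact: bil_continuous.
move=> t; apply: (@cvgZ _ _ _ _ _ (fun t => rsqrt (- lorentz (y t) (y t))) y); last exact: cy.
have lpos : 0 < - lorentz (y t) (y t).
  have := rayroot_eq (g0 t) (gn t); rewrite QE -/(y t).
  have yn : y t != 0.
    apply/eqP => /rowP/(_ k0); rewrite !mxE g0 /= mulr0 addr0 => /eqP.
    by rewrite oner_eq0.
  by case: posA => _ /(_ _ yn); lra.
apply: (@continuous_comp _ _ _ (fun t => - lorentz (y t) (y t)) rsqrt); first exact: ly.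
by apply: differentiable_continuous; apply/derivable1_diffP; case: (is_derive_rsqrt lpos).
Qed.

(** Radial projection from [e0] maps the nonzero spatial vectors onto the surface. It carries paths
    from one fixed vector to all the others into connected subsets with a common point. *)
Lemma surf_connected : connected S.
Proof.
(* A segment from e1 to [w] could pass through 0. The last term bends it away when w3 = 0; when w3
   is nonzero, the third coordinate t w3 already vanishes only at t = 0. *)
pose g (w : E) (t : R) : E := (1 - t) *: (delta_mx 0 k1) + t *: w
  + (t * (1 - t) * (w 0 k3 == 0)%:R) *: (delta_mx 0 k3).
pose D : set E := [set w : E | w 0 k0 = 0 /\ w != 0].
have gD w t : D w -> D (g w t).
  move=> [w0 wn]; split; first by rewrite !mxE w0 /=; ring.
  apply/eqP => e; have eg i : g w t 0 i = 0.
    by rewrite e; apply: (@eq_trans _ _ ((0 : 'rV[R]_4) 0 i)); rewrite // mxE.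
  have := eg k3; have := eg k1; rewrite !mxE /=.
  rewrite ?(mulr0, mulr1, add0r, addr0) => e1 e3.
  have tE : t = 0 \/ t = 1 /\ w 0 k3 == 0.
    move: e3; case: eqP => [->|/eqP w3].
      rewrite mulr0 mulr1 add0r => /eqP; rewrite mulf_eq0 subr_eq0.
      by move=> /orP[/eqP|/eqP]; [left|right].
    by rewrite mulr0 addr0 => /eqP; rewrite mulf_eq0 (negbTE w3) orbF => /eqP; left.
  case: tE => [t0|[t1 _]].
    by move: e1; rewrite t0 subr0 mul0r addr0 => /eqP; rewrite oner_eq0.
  move: e; rewrite t1 /g subrr scale0r add0r scale1r mulr0 mul0r scale0r addr0.
  exact/eqP.
have cg w : continuous (g w).
  move=> t; apply: cvgD.
    apply: cvgD; apply: cvgZr_tmp; last exact: cvg_id.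
    by apply: cvgB; [exact: cvg_cst|exact: cvg_id].
  apply: cvgZr_tmp; apply: cvgM; last exact: cvg_cst.
  apply: cvgM; first exact: cvg_id.
  by apply: cvgB; [exact: cvg_cst|exact: cvg_id].
have -> : S = \bigcup_(w in D) ((rayend \o g w) @` setT).
  apply/seteqP; split=> x.
    move=> /surf_rayend[w [w0 wn <-]]; exists w; first by split.
    have gw1 : g w 1 = w.
      by rewrite /g subrr scale0r add0r scale1r mulr0 mul0r scale0r addr0.
    by exists 1; [|exact: (congr1 rayend gw1)].
  by move=> [w Dw [t _ <-]]; have [a b] := gD w t Dw; exact: rayend_surf.
apply: bigcup_connected.
  exists (rayend (delta_mx 0 k1)) => w Dw.
  have gw0 : g w 0 = delta_mx 0 k1.
    by rewrite /g subr0 !mul0r !scale0r !addr0 scale1r.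
  by exists 0; [|exact: (congr1 rayend gw0)].
move=> w Dw; apply: connected_continuous_connected.
  by apply/connected_intervalP => ? ? ? ?.
apply: continuous_subspaceT; apply: rayend_continuous => // t.
  by case: (gD w t Dw).
by case: (gD w t Dw).
Qed.

Lemma surf_closed_surface : closed_surface S.
Proof.
split; [|exact: surf_embedded|exact: surf_compact|exact: surf_connected].
exists (rayend (delta_mx 0 k1)); apply: rayend_surf; first by rewrite mxE.
by apply/eqP => /rowP/(_ k1)/eqP; rewrite !mxE /= oner_eq0.
Qed.

End Surface.

(** * Totally geodesic planes *)

Section ContinuousAt.
Context {R : realType} {T : topologicalType} (x : T).
Implicit Type V : normedModType R.

Lemma cfor_cst {U : topologicalType} (c : U) : {for x, continuous (fun _ : T => c)}.
Proof. exact: cvg_cst. Qed.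

Lemma cfor_id : {for x, continuous (fun y : T => y)}.
Proof. exact: cvg_id. Qed.

Lemma cforD {V} (f g : T -> V) : {for x, continuous f} -> {for x, continuous g} ->
  {for x, continuous (fun y => f y + g y)}.
Proof. exact: cvgD. Qed.

Lemma cforB {V} (f g : T -> V) : {for x, continuous f} -> {for x, continuous g} ->
  {for x, continuous (fun y => f y - g y)}.
Proof. exact: cvgB. Qed.

Lemma cforZ {V} (k : T -> R) (f : T -> V) : {for x, continuous k} ->
  {for x, continuous f} -> {for x, continuous (fun y => k y *: f y)}.
Proof. exact: cvgZ. Qed.

Lemma cforM (f g : T -> R) : {for x, continuous f} -> {for x, continuous g} ->
  {for x, continuous (fun y => f y * g y)}.
Proof. exact: cvgM. Qed.

Lemma cforV (f : T -> R) : f x != 0 -> {for x, continuous f} ->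
  {for x, continuous (fun y => (f y)^-1)}.
Proof. exact: cvgV. Qed.

Lemma cfor_coord (f : T -> 'rV[R]_4) i : {for x, continuous f} ->
  {for x, continuous (fun y => f y 0 i)}.
Proof.
move=> cf; apply: (@continuous_comp _ _ _ f (fun v : 'rV[R]_4 => v 0 i)) => //.
exact: coord_continuous.
Qed.

Lemma cfor_lorentz (f g : T -> 'rV[R]_4) : {for x, continuous f} ->
  {for x, continuous g} -> {for x, continuous (fun y => lorentz (f y) (g y))}.
Proof.
move=> cf cg; have cfi i := cfor_coord (i := i) cf; have cgi i := cfor_coord (i := i) cg.
rewrite (_ : (fun y => _) = (fun y => 0 - f y 0 k0 * g y 0 k0 + f y 0 k1 * g y 0 k1
  + f y 0 k2 * g y 0 k2 + f y 0 k3 * g y 0 k3)); last first.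
  by apply/funext => y; rewrite lorentzE add0r.
apply: cforD; last exact: cforM.
apply: cforD; last exact: cforM.
apply: cforD; last exact: cforM.
by apply: cforB; [exact: cfor_cst|exact: cforM].
Qed.

Lemma cfor_rsqrt (f : T -> R) : 0 < f x -> {for x, continuous f} ->
  {for x, continuous (fun y => rsqrt (f y))}.
Proof.
move=> f0 cf; apply: (@continuous_comp _ _ _ f (@rsqrt R)) => //.
by apply: differentiable_continuous; apply/derivable1_diffP; case: (is_derive_rsqrt f0).
Qed.

End ContinuousAt.

(** * Hyperplane sections of the hyperboloid *)

Section Planes.
Context {R : realType}.
Local Notation E := 'rV[R]_4.

Lemma lorentzDl x y z : lorentz (x + y) z = lorentz x z + lorentz y z :> R.
Proof. by rewrite lorentz_bil bilDl. Qed.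
Lemma lorentzDr x y z : lorentz z (x + y) = lorentz z x + lorentz z y :> R.
Proof. by rewrite lorentz_bil bilDr. Qed.
Lemma lorentzZl a x y : lorentz (a *: x) y = a * lorentz x y :> R.
Proof. by rewrite lorentz_bil bilZl. Qed.
Lemma lorentzZr a x y : lorentz x (a *: y) = a * lorentz x y :> R.
Proof. by rewrite lorentz_bil bilZr. Qed.
Lemma lorentzNl x y : lorentz (- x) y = - lorentz x y :> R.
Proof. by rewrite lorentz_bil bilNl. Qed.
Lemma lorentzNr x y : lorentz x (- y) = - lorentz x y :> R.
Proof. by rewrite lorentz_bil bilNr. Qed.
Lemma lorentz0l y : lorentz 0 y = 0 :> R.
Proof. by rewrite lorentz_bil bil0l. Qed.

Definition lorentz_lin := (lorentzDl, lorentzDr, lorentzZl, lorentzZr, lorentzNl, lorentzNr).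

(** The hypothesis says (1 - c) (1 + c) = a^2 N c^2. The form of the result extracts a factor [a]
    from 1 - c even when [a] vanishes. *)
Lemma foot_scale (a c N : R) : c ^+ 2 * (1 + a ^+ 2 * N) = 1 -> 1 + c != 0 ->
  a * (a * N * c ^+ 2 / (1 + c)) = 1 - c.
Proof.
move=> r2 r1.
have -> : a * (a * N * c ^+ 2 / (1 + c)) = (c ^+ 2 * (1 + a ^+ 2 * N) - c ^+ 2) / (1 + c).
  by field.
by rewrite r2; field.
Qed.

Definition plane (n : E) : set E := [set x | H3 x /\ lorentz n x = 0].

Lemma is_derive_lorentzr (n x v : E) :
  is_derive x v (fun z : E => lorentz n z : R^o) (lorentz n v).
Proof.
rewrite lorentz_bil.
have := is_derive_bil lorentz_mx (is_derive_cst n x v) (is_derive_id x v).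
by move=> /is_derive_eq; apply; rewrite bil0l add0r.
Qed.

Lemma plane_embedded n : 0 < lorentz n n -> embedded_surface (plane n).
Proof.
move=> nn; split=> [x []//|p [Hp np]].
exists setT, (fun x => lorentz n x : R^o); split.
- by split=> //; exact: openT.
- move=> k; rewrite lorentz_bil; apply: Ck_on_bil; first exact: openT.
    exact: Ck_on_cst.
  exact: Ck_on_id.
- by rewrite setIT; apply/seteqP; split=> x /= [] => [? ?|? _ ?].
- exists n; first by rewrite /tangent_H3 /= lorentzC.
  by have [_ ->] := is_derive_lorentzr n p n; exact: lt0r_neq0.
Qed.

(** One direction differentiates both equations along a curve. For the other, the straight line p +
    t v stays in the hyperplane and is rescaled to the hyperboloid. *)
Lemma plane_tangentP n p v : plane n p ->
  tangent_space (plane n) p v <-> lorentz p v = 0 /\ lorentz n v = 0.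
Proof.
move=> [Hp np]; have [p1 _] := Hp; split.
  move=> [c [e [[e_gt0 sc] Sc c0 <-]]].
  have b0 : ball (0 : R^o) e 0 by exact: ballxx.
  have dc : is_derive (0 : R) (1 : R) c (velocity c 0).
    apply: derivable_velocity; apply: diff_derivable.
    by have [] := sc 1%N => /(_ _ b0).
  have near0 : \forall t \near (0 : R^o), plane n (c t).
    by apply/nbhs_ballP; exists e => //= t /Sc.
  have dn : is_derive (0 : R) (1 : R) (fun _ : R => n) 0 by exact: is_derive_cst.
  split.
    have nk : \forall t \near (0 : R), lorentz (c t) (c t) = cst (-1) t.
      by apply: filterS near0 => t [[]].
    have [_] := near_eq_is_derive nk (is_derive_lorentz dc dc).
    by rewrite c0 (lorentzC _ p) => e1; have := derive_cst (-1 : R^o) (0 : R) (1 : R); rewrite e1; lra.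
  have nk : \forall t \near (0 : R), lorentz n (c t) = cst 0 t.
    by apply: filterS near0 => t [].
  have [_] := near_eq_is_derive nk (is_derive_lorentz dn dc).
  by rewrite lorentz0l add0r => <-; exact: derive_cst.
move=> [pv nv].
pose y (t : R^o) : E := p + t *: v.
have sy : smooth_on setT y.
  move=> k; apply: Ck_on_add; [exact: openT|exact: Ck_on_cst|].
  by apply: Ck_on_scale; [exact: openT|exact: Ck_on_id].
have y0 : y 0 = p by rewrite /y scale0r addr0.
have dy : is_derive (0 : R^o) (1 : R^o) y v.
  have := is_deriveD (is_derive_cst p (0 : R) (1 : R))
    (is_derive_scalev v (is_derive_id (0 : R) (1 : R))).
  by move=> /is_derive_eq; apply; rewrite add0r scale1r.
have [e [e_gt0 /= [sc Hc c0 vc]]] := rescaled_curve sy y0 Hp dy.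
exists (fun t => rsqrt (- lorentz (y t) (y t)) *: y t), e; split=> //.
  move=> t /Hc Ht; split=> //.
  suff nyt : lorentz n (y t) = 0 by rewrite lorentzZr nyt mulr0.
  by rewrite /y lorentzDr lorentzZr np nv mulr0 addr0.
by rewrite vc /tangential lorentzC pv scale0r addr0.
Qed.

(** Segments from a fixed point of the plane stay timelike and inside the hyperplane; their radial
    projections reach every point. *)
Lemma plane_connected n : connected (plane n).
Proof.
have [[p Hp]|ne] := pselect (plane n !=set0); last first.
  have -> : plane n = set0 by apply/seteqP; split=> // x px; apply: ne; exists x.
  exact: connected0.
pose y x (s : R) : E := (1 - s) *: p + s *: x.
pose g x s := rsqrt (- lorentz (y x s) (y x s)) *: y x s.
have [[p1 p0] np] := Hp.
have yy x s : plane n x -> 0 <= s <= 1 -> lorentz (y x s) (y x s) < 0.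
  move=> [Hx _] /andP[s0 s1]; have := lorentz_lt0 (proj1 Hp) Hx; have [x1 _] := Hx.
  rewrite /y !lorentz_lin p1 x1 (lorentzC x p) => px.
  have u0 : 0 <= s * (1 - s) by rewrite mulr_ge0 // subr_ge0.
  have up : s * (1 - s) * lorentz p x <= 0 by rewrite mulr_ge0_le0 // ltW.
  by have := sqr_ge0 (s - 1 / 2); lra.
have -> : plane n = \bigcup_(x in plane n) (g x @` `[0, 1]).
  apply/seteqP; split=> z /=.
    move=> Hz; exists z => //; exists 1; first by rewrite /= in_itv /= lexx ler01.
    rewrite /g /y subrr scale0r add0r scale1r; have [[-> _] _] := Hz.
    by rewrite opprK /rsqrt ln1 mul0r oppr0 expR0 scale1r.
  move=> [x Hx [s]]; rewrite /= in_itv /= => s01 <-.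
  have := yy x s Hx s01; have [[x1 x0] nx] := Hx; move: s01 => /andP[s0 s1] yn.
  split; last first.
    by rewrite /g lorentzZr /y !lorentz_lin np nx !mulr0 addr0 mulr0.
  apply: H3_rescale => //; rewrite /y !mxE.
  have [->|sn] := eqVneq s 0; first by rewrite subr0 mul1r mul0r addr0.
  have sp : 0 < s by rewrite lt_neqAle eq_sym sn.
  by rewrite ltr_wpDl // ?mulr_ge0 ?mulr_gt0 ?subr_ge0 // ltW.
apply: bigcup_connected.
  exists p => x Hx; exists 0; first by rewrite /= in_itv /= lexx ler01.
  rewrite /g /y subr0 scale0r addr0 scale1r p1.
  by rewrite opprK /rsqrt ln1 mul0r oppr0 expR0 scale1r.
move=> x Hx; apply: connected_continuous_connected; first exact: segment_connected.
apply: continuous_in_subspaceT => s; rewrite inE /= in_itv /= => s01.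
have cy : {for s, continuous (y x)}.
  apply: cforD; apply: cforZ; try exact: cfor_cst; last exact: cfor_id.
  by apply: cforB; [exact: cfor_cst|exact: cfor_id].
apply: (@cforZ _ _ s _ (fun s => rsqrt (- lorentz (y x s) (y x s))) (y x)); last exact: cy.
apply: (@cfor_rsqrt _ _ s (fun s => - lorentz (y x s) (y x s))); first by rewrite oppr_gt0 yy.
rewrite (_ : (fun z => _) = (fun z => 0 - lorentz (y x z) (y x z))); last first.
  by apply/funext => z; rewrite add0r.
by apply: cforB; [exact: cfor_cst|exact: cfor_lorentz].
Qed.

Lemma plane_ctg n : 0 < lorentz n n -> plane n !=set0 ->
  complete_totally_geodesic (plane n).
Proof.
move=> nn ne; split=> //; [exact: plane_embedded|exact: plane_connected|].
move=> c gc c0 /(plane_tangentP _ c0)[_ nv] t.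
have [fr ->] := geodesic_is_hline gc; split; first by case: (hline_frame t fr).
by rewrite lorentzC lorentz_hline !(lorentzC _ n) nv (proj2 c0) !mulr0 addr0.
Qed.

(** * Coincidence of a surface with a plane it contains *)

Section Rigidity.
Context (n x : E) (nn : 0 < lorentz n n) (px : plane n x).

(* Foot of the perpendicular from y to the plane, as a point of H3, and the
   direction of the chord from it to y, which tends to n as y tends to x. *)
Let h (y : E) : R := lorentz n y / lorentz n n.
Let y' (y : E) : E := y - h y *: n.
Let r (y : E) : R := rsqrt (- lorentz (y' y) (y' y)).
Let foot (y : E) : E := r y *: y' y.
Let dir (y : E) : E := n + (h y * lorentz n n * r y ^+ 2 / (1 + r y)) *: y' y.

Let hx : h x = 0. Proof. by rewrite /h (proj2 px) mul0r. Qed.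

Let y'x : y' x = x. Proof. by rewrite /y' hx scale0r subr0. Qed.

Let rx : r x = 1.
Proof.
by rewrite /r y'x; have [[-> _] _] := px; rewrite opprK /rsqrt ln1 mul0r oppr0 expR0.
Qed.

Let y'y' y : H3 y -> - lorentz (y' y) (y' y) = 1 + h y ^+ 2 * lorentz n n.
Proof.
move=> [y1 _]; rewrite /y' !lorentz_lin y1 (lorentzC y n).
have -> : lorentz n y = h y * lorentz n n by rewrite /h divfK // lt0r_neq0.
by ring.
Qed.

Let chord y : H3 y -> y - foot y = h y *: dir y.
Proof.
move=> Hy; have k0 : 0 < - lorentz (y' y) (y' y).
  by rewrite y'y' // ltr_pwDl // mulr_ge0 ?sqr_ge0 // ltW.
have r2 : r y ^+ 2 * (1 + h y ^+ 2 * lorentz n n) = 1 by rewrite -y'y' //; exact: rsqrt_sq.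
have r0 : 0 < r y := rsqrt_gt0 _.
have r1 : 1 + r y != 0 by rewrite gt_eqF // addr_gt0.
have e : h y * (h y * lorentz n n * r y ^+ 2 / (1 + r y)) = 1 - r y.
  exact: foot_scale.
rewrite /dir scalerDr scalerA e /foot -/(r y) scalerBl scale1r addrA.
congr (_ - _); by rewrite /y' addrC subrK.
Qed.

Let foot_plane y : H3 y -> 0 < y' y 0 k0 -> plane n (foot y).
Proof.
move=> Hy y0; split.
  apply: H3_rescale => //; rewrite -oppr_gt0 y'y' //.
  by rewrite ltr_pwDl // mulr_ge0 ?sqr_ge0 // ltW.
rewrite /foot /y' !lorentz_lin /h divfK ?lt0r_neq0 //.
by rewrite subrr mulr0.
Qed.

Let h_cont : {for x, continuous h}.
Proof.
apply: cforM; last exact: cfor_cst.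
by apply: cfor_lorentz; [exact: cfor_cst|exact: cfor_id].
Qed.

Let y'_cont : {for x, continuous y'}.
Proof.
apply: cforB; first exact: cfor_id.
by apply: cforZ; [exact: h_cont|exact: cfor_cst].
Qed.

Let r_cont : {for x, continuous r}.
Proof.
apply: (@cfor_rsqrt _ _ x (fun y => - lorentz (y' y) (y' y))).
  by rewrite y'x; have [[-> _] _] := px; rewrite opprK.
rewrite (_ : (fun z => _) = (fun z => 0 - lorentz (y' z) (y' z))); last first.
  by apply/funext => z; rewrite add0r.
by apply: cforB; [exact: cfor_cst|exact: cfor_lorentz].
Qed.

Let foot_cont : {for x, continuous foot}.
Proof. exact: cforZ. Qed.

Let foot_x : foot x = x.
Proof. by rewrite /foot rx y'x scale1r. Qed.

Let dir_cont : {for x, continuous dir}.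
Proof.
apply: cforD; first exact: cfor_cst.
apply: cforZ; last exact: y'_cont.
apply: cforM; last first.
  apply: cforV; first by rewrite rx; apply: lt0r_neq0; lra.
  by apply: cforD; [exact: cfor_cst|exact: r_cont].
apply: cforM; last by apply: (cforM r_cont r_cont).
by apply: cforM; [exact: h_cont|exact: cfor_cst].
Qed.

Let dir_x : dir x = n.
Proof. by rewrite /dir hx !mul0r scale0r addr0. Qed.

(* A surface containing the plane coincides with it near x: otherwise the
   mean value theorem along short chords, whose directions tend to n, would
   make the normal derivative of a local equation vanish at x. *)
Lemma plane_isolated (P : set E) : embedded_surface P -> plane n `<=` P ->
  \forall y \near x, P y -> plane n y.
Proof.
move=> [PH3 emb] nP.
have [U [f [[oU Ux] sf PU [v0 tv0 fv0]]]] := emb x (nP x px).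
have [df cdf] := sf 1%N.
have [[x1 x0] nx] := px.
have fz z : U z -> P z -> f z = 0.
  by move=> Uz Pz; have : (P `&` U) z by []; rewrite PU => -[].
(* As [f] vanishes along curves in the plane, so do its derivatives in the directions tangent to the
   plane. *)
have fplane v : lorentz x v = 0 -> lorentz n v = 0 -> 'D_v f x = 0.
  move=> xv nv; have [c [e [[e_gt0 sc] Sc c0 vc]]] := (plane_tangentP v px).2 (conj xv nv).
  have b0 : ball (0 : R^o) e 0 by exact: ballxx.
  have dc0 : differentiable c 0 by have [] := sc 1%N => /(_ _ b0).
  have dfc : differentiable f (c 0) by rewrite c0; exact: df.
  have : 'D_1 (f \o c : R^o -> R^o) 0 = 0.
    rewrite (@near_eq_derive _ _ _ (f \o c) (cst 0) 0 1); first exact: derive_cst.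
    have cU : \forall t \near (0 : R^o), U (c t).
      have := differentiable_continuous dc0; rewrite /prop_for /continuous_at c0.
      by apply; exact: open_nbhs_nbhs.
    near=> t; rewrite /=; apply: fz; first by near: t.
    by apply/nP/Sc; near: t; apply/nbhs_ballP; exists e.
  rewrite deriveE; last exact: differentiable_comp.
  rewrite diff_comp //= -(deriveE (1 : R^o) dc0) -derive1E -/(velocity c 0) vc c0.
  by rewrite -deriveE //; exact: df.
have dfx := df x Ux.
(* The tangent space of H^3 at [x] is spanned by that of the plane and [n], so regularity of [f]
   leaves only the normal derivative. *)
have fn : 'D_n f x != 0.
  apply: contra_neq fv0 => fn0.
  have dl a c u : 'D_(a + c *: u) f x = 'D_a f x + c * 'D_u f x.
    by rewrite !deriveE // linearD linearZ.
  rewrite -(subrK (h v0 *: n) v0) dl fn0 mulr0 addr0.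
  apply: fplane; rewrite !lorentz_lin.
    by rewrite tv0 (lorentzC x) nx mulr0 subrr.
  by rewrite /h divfK ?subrr // lt0r_neq0.
(* The derivative as a function of point and direction jointly; its continuity at (x, n) keeps it
   nonzero for nearby points and directions. *)
pose D (zw : E * E) : R := \sum_i zw.2 0 i * 'D_(delta_mx 0 i) f zw.1.
have DE z w : U z -> D (z, w) = 'D_w f z.
  move=> Uz; rewrite [in RHS](row_sum_delta w) deriveE; last exact: df.
  rewrite linear_sum; apply: eq_bigr => i _.
  by rewrite linearZ /= -deriveE //; exact: df.
have Dc : {for ((x, n) : E * E), continuous D}.
  have c1 i : {for ((x, n) : E * E), continuous (fun zw : E * E => zw.2 0 i * 'D_(delta_mx 0 i) f zw.1)}.
    apply: cforM; first by apply: cfor_coord; exact: cvg_snd.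
    apply: (@continuous_comp _ _ _ (fun zw : E * E => zw.1) (fun w : E => 'D_(delta_mx 0 i) f w)).
      exact: cvg_fst.
    exact: cdf.
  rewrite (_ : D = fun zw => zw.2 0 k0 * 'D_(delta_mx 0 k0) f zw.1 + zw.2 0 k1 * 'D_(delta_mx 0 k1) f zw.1
    + zw.2 0 k2 * 'D_(delta_mx 0 k2) f zw.1 + zw.2 0 k3 * 'D_(delta_mx 0 k3) f zw.1).
    do 3![apply: cforD; last exact: c1]; exact: c1.
  by apply/funext => zw; rewrite /D sum4.
have Dn0 : D (x, n) != 0 by rewrite DE.
have nD : \forall zw \near (x, n), D zw != 0.
  have : nbhs (D (x, n)) [set r | r != 0].
    by apply: open_nbhs_nbhs; split; [exact: open_neq|].
  by move=> /Dc.
have nU : \forall z \near x, U z by exact: open_nbhs_nbhs.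
have [/= [A B] [/nbhs_ballP[e /= e_gt0 eA] nB] AB] := nD.
have [/= e2 e2_gt0 eU] := (nbhs_ballP _ _).1 nU.
pose e3 := Num.min e e2.
have e3_gt0 : 0 < e3 by rewrite lt_min e_gt0.
near=> y => Py.
have Hy : H3 y by exact: PH3.
have by3 : ball x e3 y by near: y; exact: nbhsx_ballx.
have bf3 : ball x e3 (foot y).
  near: y; apply: foot_cont; rewrite foot_x; exact: nbhsx_ballx.
have Bd : B (dir y) by near: y; apply: dir_cont; rewrite dir_x.
have y0 : 0 < y' y 0 k0.
  near: y.
  have := cfor_coord (i := k0) y'_cont.
  by rewrite /prop_for /continuous_at => /cvgr_gt; apply; rewrite y'x.
have pf := foot_plane Hy y0.
pose z (s : R) : E := foot y + s *: (y - foot y).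
have bz s : 0 <= s <= 1 -> ball x e3 (z s).
  move=> /andP[s0 s1]; move: by3 bf3; rewrite -!ball_normE /ball_ /= => by3 bf3.
  have -> : x - z s = (1 - s) *: (x - foot y) + s *: (x - y).
    by apply/rowP => i; rewrite !mxE; ring.
  apply: le_lt_trans (ler_normD _ _) _; rewrite !normrZ (ger0_norm s0) ger0_norm ?subr_ge0 //.
  have [->|sn] := eqVneq s 0; first by rewrite subr0 mul1r mul0r addr0.
  have sp : 0 < s by rewrite lt_neqAle eq_sym sn.
  have h1 : 0 <= (1 - s) * (e3 - `|x - foot y|).
    by rewrite mulr_ge0 // subr_ge0 // ltW.
  have h2 : 0 < s * (e3 - `|x - y|) by rewrite mulr_gt0 // subr_gt0.
  by rewrite -subr_gt0; lra.
have Uz s : 0 <= s <= 1 -> U (z s).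
  by move=> /bz bs; apply: eU; apply: le_ball bs; rewrite /e3 ge_min lexx orbT.
have dz (s : R) : 0 <= s <= 1 -> is_derive s (1 : R) (f \o z) ('D_(y - foot y) f (z s)).
  move=> s01; have dfz := df _ (Uz s s01).
  have dz : is_derive s (1 : R) z (y - foot y).
    have := is_deriveD (is_derive_cst (foot y) s (1 : R))
      (is_derive_scalev (y - foot y) (is_derive_id s (1 : R))).
    by move=> /is_derive_eq; apply; rewrite add0r scale1r.
  have dz' : differentiable (z : R^o -> E) s by apply/derivable1_diffP; case: dz.
  apply: DeriveDef.
    by apply/derivable1_diffP; exact: differentiable_comp.
  rewrite deriveE; last exact: differentiable_comp.
  rewrite diff_comp //= -(deriveE (1 : R^o) dz'); case: dz => _ ->.
  by rewrite -deriveE.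
have cz : {within `[0, 1], continuous (f \o z)}.
  apply: continuous_in_subspaceT => s; rewrite inE /= in_itv /= => s01.
  by apply: differentiable_continuous; apply/derivable1_diffP; case: (dz s s01).
(* Both ends of the chord lie in [P], where [f] is zero. Hence [h y] times a nonzero derivative is
   0, and [h y] vanishes. *)
have [||s s01] := @MVT R (f \o z) (fun s => 'D_(y - foot y) f (z s)) 0 1 ltr01.
- by move=> s; rewrite in_itv /= => /andP[s0 s1]; apply: dz; rewrite !ltW.
- exact: cz.
have s01' : 0 <= s <= 1 by move: s01; rewrite in_itv /= => /andP[s0 s1]; rewrite !ltW.
have z1 : z 1 = y by rewrite /z scale1r addrC subrK.
have z0 : z 0 = foot y by rewrite /z scale0r addr0.
rewrite /= z1 z0 (fz y) //; last by rewrite -z1; apply: Uz; rewrite ler01 lexx.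
rewrite (fz (foot y)); [|by rewrite -z0; apply: Uz; rewrite ler01 lexx|exact: nP].
rewrite subrr subr0 mulr1 chord // deriveE; last exact/df/Uz.
rewrite linearZ /= -deriveE; last exact/df/Uz.
rewrite -DE; last exact: Uz.
move=> /esym/eqP; rewrite scaler_eq0 => /orP[/eqP hy|].
  split=> //; move: hy; rewrite /h => /eqP; rewrite mulf_eq0 invr_eq0 (gt_eqF nn) orbF.
  by move=> /eqP.
have Dz : D (z s, dir y) != 0.
  apply: AB; split=> //=; apply: eA; apply: le_ball (bz s s01').
  by rewrite /e3 ge_min lexx.
by rewrite (negbTE Dz).
Unshelve. all: by end_near. Qed.

End Rigidity.

(** Every point of the plane is joined to [p] by a geodesic tangent to [P] at [p], so [P] contains
    the plane. The plane is open in [P] by [plane_isolated] and also closed, and [P] is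
    connected. *)
Lemma ctg_sub_plane (P : set E) (n p : E) : 0 < lorentz n n -> plane n p ->
  complete_totally_geodesic P -> P p ->
  (forall v, lorentz p v = 0 -> lorentz n v = 0 -> tangent_space P p v) ->
  P = plane n.
Proof.
move=> nn pp [_ embP conP geoP] Pp tP.
have nP : plane n `<=` P.
  move=> x px; have [<-//|ne] := eqVneq p x.
  have [[Hp np] [Hx nx]] := (pp, px).
  have [d0 fr xE] := geodesic_to Hp Hx ne.
  rewrite xE; set v := _ *: _ in fr *.
  have v0 : velocity (hline p v) 0 = v by rewrite velocity_hline hline0.
  have := geoP _ (geodesic_hline fr); rewrite hline0 v0; apply => //.
  case: fr => _ pv _; apply: tP => //.
  by rewrite /v !lorentz_lin nx np mulr0 subrr mulr0.
apply/esym/conP; first by exists p.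
  exists [set x | \forall y \near x, P y -> plane n y].
    rewrite openE => x /= nx; rewrite /interior /=.
    exact: (nbhs_interior nx).
  apply/seteqP; split=> [x px|x [Px /nbhs_singleton]]; last exact.
  by split; [exact: nP|exact: plane_isolated].
exists [set x | lorentz n x = 0].
  have -> : [set x | lorentz n x = 0] = (fun x : E => lorentz n x) @^-1` [set 0] by [].
  apply: closed_comp => [x _|]; last first.
    exact/accessible_closed_set1/hausdorff_accessible/Rhausdorff.
  by apply: cfor_lorentz; [exact: cfor_cst|exact: cfor_id].
apply/seteqP; split=> [x px|x [Px nx]]; first by split; [exact: nP|case: px].
by split=> //; case: embP => + _; exact.
Qed.

End Planes.

(** * One step of the outer billiard *)

Section Billiard.
Context {R : realType}.
Local Notation E := 'rV[R]_4.

(** For [p] on the hyperboloid, the linear isometry that fixes [p] and is -1 on its orthogonal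
    complement: the point reflection in [p]. *)
Definition refl (p y : E) : E := - y - (2 * lorentz y p) *: p.

Lemma hline_back (x u : E) t : hline (hline x u t) (hline u x t) (- t) = x.
Proof. by rewrite -hlineD addNr hline0. Qed.

Lemma line_of_shift (x u : E) t : line_of (hline (hline x u t) (hline u x t)) = line_of (hline x u).
Proof.
apply/seteqP; split=> b [t0 ->]; [exists (t0 + t)|exists (t0 - t)]; apply/funext => s.
  by rewrite -hlineD addrA.
by rewrite -hlineD -addrA subrK.
Qed.

Lemma line_of_hline (x u : E) a : frame x u -> line_of (hline x u) a ->
  exists t, a = hline (hline x u t) (hline u x t).
Proof. by move=> fr [t ->]; exists t; apply/funext => s; rewrite hlineD. Qed.

Lemma hline_refl (p x u : E) t :
  hline (refl p x) (- refl p u) (- t) = refl p (hline x u t).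
Proof.
rewrite /hline chN shN scalerN scaleNr opprK /refl !lorentz_lin.
by apply/rowP => i; rewrite !mxE; ring.
Qed.

Lemma hline_Nrefl (p x u : E) t :
  hline (- refl p u) (refl p x) (- t) = - refl p (hline u x t).
Proof.
rewrite /hline chN shN scalerN scaleNr /refl !lorentz_lin.
by apply/rowP => i; rewrite !mxE; ring.
Qed.

(** A hyperbolic rotation of the pair (x, u) has determinant 1, so the orientation test does not
    depend on the point of the line. *)
Lemma vol_hline (x u w z : E) t : vol (hline x u t) w z (hline u x t) = vol x w z u.
Proof.
rewrite -[RHS]mul1r -(ch2sh2 t) /vol /hline !mxE; ring.
Qed.

Lemma vol_mod (x u w z : E) a b s a' b' s' :
  vol x (a *: x + b *: u + s *: w) (a' *: x + b' *: u + s' *: z) u = s * s' * vol x w z u.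
Proof. rewrite /vol !mxE; ring. Qed.

(** This turns the orientation condition on the two parallel fields into one on the two tangency
    points, since [sh] is positive at positive distances. *)
Lemma vol_feet (x u p q v w : E) t t' d d' :
  p = hline (hline x u t) v d -> q = hline (hline x u t') w d' ->
  vol x p q u = sh d * sh d' * vol x v w u.
Proof. by move=> -> ->; rewrite /hline !scalerDr !scalerA vol_mod. Qed.

Lemma vol_dup (x u w : E) : vol x w w u = 0.
Proof. rewrite /vol; ring. Qed.

Lemma vol_swap (x u w z : E) : vol x z w u = - vol x w z u.
Proof. rewrite /vol; ring. Qed.

(** The quantities -<x, q> and -<u, q> are put in hyperbolic polar coordinates. The parameter [tau]
    is that of the foot of the perpendicular from [q], and [D] is cosh of its length. *)
Lemma line_height (x u q : E) : frame x u -> H3 q ->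
  exists D tau, [/\ 0 < D,
    forall t, - lorentz (hline x u t) q = D * ch (t - tau)
  & forall t, - lorentz (hline u x t) q = D * sh (t - tau)].
Proof.
move=> [Hx xu uu] Hq; have [[x1 _] [q1 _]] := (Hx, Hq).
have A0 : 0 < - lorentz x q by rewrite oppr_gt0; exact: lorentz_lt0.
have AB : lorentz u q ^+ 2 < (- lorentz x q) ^+ 2.
  pose w := q + lorentz x q *: x - lorentz u q *: u.
  have xw : lorentz x w = 0 by rewrite /w !lorentz_lin x1 xu; ring.
  have [w0 _] := tangent_posdef x1 xw.
  move: w0; rewrite /w !lorentz_lin q1 x1 uu (lorentzC u x) xu (lorentzC q x) (lorentzC q u).
  lra.
have [D [tau [D0 xE uE]]] := polar_hyp A0 AB; exists D, tau; split=> // t.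
- by rewrite lorentz_hline chD chN shN -[lorentz x q]opprK xE uE; ring.
- by rewrite lorentz_hline shD chN shN -[lorentz x q]opprK xE uE; ring.
Qed.

Lemma sh_eq0 (t : R) : ch t <= 1 -> sh t = 0.
Proof.
move=> c1; have := ch2sh2 t; have := ch_gt0 t; have := sqr_ge0 (sh t) => s0 c0 cs.
by apply/eqP; rewrite -sqrf_eq0; apply/eqP; nra.
Qed.

Context (A : 'M[R]_4) (posA : posform A) (A00 : bil A e0 e0 < 1).
Local Notation Q := (bil (Qm A)).
Local Notation S := (surf A).

Lemma surf_tangent_plane q : S q ->
  [/\ 0 < lorentz (Qgrad A q) (Qgrad A q), plane (Qgrad A q) q
    & tangent_space S q = tangent_space (plane (Qgrad A q)) q].
Proof.
move=> Sq; have [Hq _] := Sq.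
have pq : plane (Qgrad A q) q by split=> //; rewrite lorentz_Qgrad surfQ.
split=> //; first exact: Qgrad_gt0.
apply/seteqP; split=> v.
  move=> /(surf_tangent_sub posA Sq)[qv Qv].
  by apply/(plane_tangentP _ pq); rewrite lorentz_Qgrad.
by move=> /(plane_tangentP _ pq)[qv]; rewrite lorentz_Qgrad; exact: surf_tangent_sup.
Qed.

(** The plane orthogonal to [Qgrad A q] contains the line because Q q x = Q q u = 0. At the foot of
    the perpendicular, [v] is orthogonal to the line, so the constant field [v] is parallel. *)
Lemma tangency_exists (x u q : E) : frame x u -> S q -> Q q x = 0 -> Q q u = 0 ->
  (forall t, hline x u t != q) ->
  exists P t v,
    [/\ tangency S (hline x u) P q t (hline (hline x u t) v) (fun=> v),
        frame (hline x u t) v, lorentz v (hline u x t) = 0, 0 < hdist (hline x u t) q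
      & q = hline (hline x u t) v (hdist (hline x u t) q)].
Proof.
move=> fr Sq qx qu out; have [Hq _] := Sq.
have [nn pq tS] := surf_tangent_plane Sq.
have [D [t [D0 hx hu]]] := line_height fr Hq.
have frt := hline_frame t fr; have [Hat aa' _] := frt.
have [d0 frv qE] := geodesic_to Hat Hq (out t).
set d := hdist _ _ in d0 frv qE *; set v := _ *: _ in frv qE.
have va' : lorentz v (hline u x t) = 0.
  rewrite /v lorentzZl lorentzDl lorentzNl lorentzZl aa' (lorentzC q).
  by rewrite -[lorentz (hline u x t) q]opprK hu subrr sh0; ring.
exists (plane (Qgrad A q)), t, v; split=> //.
have va : lorentz v (hline x u t) = 0 by case: frv => _; rewrite lorentzC.
split.
- split; first by apply: plane_ctg => //; exists q.
  move=> s; split; first by case: (hline_frame s fr).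
  by rewrite lorentz_Qgrad /hline bilDr !bilZr qx qu !mulr0 addr0.
- by split.
- move=> s; have [Has _ _] := hline_frame s fr.
  rewrite hdist_le // -lerN2 !hx subrr ch0 mulr1 ler_peMr //; first exact: ltW.
  exact: ch_ge1.
- by split; [exact: geodesic_hline|rewrite hline0|].
- split; last by rewrite velocity_hline hline0.
  apply: parallel_cst.
    by rewrite -[X in lorentz v X](hline_back x u t) lorentzC lorentz_hline
      !(lorentzC _ v) va va' !mulr0 addr0.
  by rewrite -[X in lorentz v X](hline_back u x t) lorentzC lorentz_hline !(lorentzC _ v) va va' !mulr0 addr0.
Qed.

(** The tangent plane at [q] determines [P], minimality of the distance determines the foot, and the
    parallel field is constant because it is orthogonal to the line. *)
Lemma tangency_unique (x u q : E) P t g W : frame x u ->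
  (forall t, hline x u t != q) -> tangency S (hline x u) P q t g W ->
  exists v, [/\ [/\ S q, Q q x = 0 & Q q u = 0], g = hline (hline x u t) v,
    W = (fun=> v), lorentz v (hline u x t) = 0
    & frame (hline x u t) v /\ (0 < hdist (hline x u t) q /\
      q = hline (hline x u t) v (hdist (hline x u t) q))].
Proof.
move=> fr out [[ctP aP] [Sq Pq tSP] mind [gg g0 gd] [parW Wt]].
have [Hq _] := Sq; have [nn pq tS] := surf_tangent_plane Sq.
have PE : P = plane (Qgrad A q).
  apply: ctg_sub_plane ctP Pq _ => // v qv nv.
  by rewrite -tSP; apply: surf_tangent_sup => //; rewrite -lorentz_Qgrad.
have Qa s : Q q (hline x u s) = 0 by have := aP s; rewrite PE => -[_]; rewrite lorentz_Qgrad.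
have qx : Q q x = 0 by rewrite -(hline0 x u).
have qu : Q q u = 0.
  have := Qa 1; rewrite /hline bilDr !bilZr qx mulr0 add0r => /eqP.
  by rewrite mulf_eq0 (gt_eqF (sh_gt0 ltr01)) => /eqP.
have [D [tau [D0 hx hu]]] := line_height fr Hq.
have frt := hline_frame t fr; have [Hat aa' _] := frt.
(* Comparing the distances at [t] and [tau] gives ch (t - tau) <= 1. *)
have shz : sh (t - tau) = 0.
  apply: sh_eq0; have [Has _ _] := hline_frame tau fr.
  have := mind tau; rewrite hdist_le // -lerN2 !hx subrr ch0 mulr1.
  by rewrite -[X in _ <= X]mulr1 ler_pM2l.
have qa' : lorentz (hline u x t) q = 0 by rewrite -[LHS]opprK hu shz mulr0 oppr0.
have [frg gE] := geodesic_is_hline gg; rewrite g0 in frg gE.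
set v := velocity g 0 in frg gE Wt.
set d := hdist _ _ in gd; have [d0 cd] := hdistE Hat Hq; rewrite -/d in d0 cd.
have qE : q = hline (hline x u t) v d by rewrite -[LHS]gd gE.
have dp : 0 < d.
  rewrite lt_neqAle d0 andbT; apply/eqP => de.
  by have := out t; rewrite [X in _ == X]qE -de hline0 eqxx.
have va' : lorentz v (hline u x t) = 0.
  have := qa'; rewrite lorentzC qE lorentz_hline aa' mulr0 add0r => /eqP.
  by rewrite mulf_eq0 (gt_eqF (sh_gt0 dp)) => /eqP.
exists v; split=> //.
have Wo : lorentz (W t) (hline u x t) = 0 by rewrite Wt.
by rewrite (parallel_orth_cst fr parW Wo) Wt.
Qed.

(** * A line lying in two given tangent planes *)

Section Step.
Context (x u p p' : E) (fr : frame x u) (Sp : S p) (Sp' : S p').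
Context (px : Q p x = 0) (pu : Q p u = 0) (p'x : Q p' x = 0) (p'u : Q p' u = 0).
Context (ori : 0 < vol x p p' u).

Let ori0 : vol x p p' u != 0. Proof. exact: lt0r_neq0. Qed.

Let pp' : p != p'.
Proof. by apply: contra_neq ori0 => ->; rewrite vol_dup. Qed.

(** A common point would satisfy Q p z = 0 and so equal [p] by strict convexity; but [p] on the line
    makes the volume vanish. *)
Let out_S t : ~ S (hline x u t).
Proof.
move=> Sz; have pz : Q p (hline x u t) = 0 by rewrite /hline bilDr !bilZr px pu !mulr0 addr0.
have [e|ne] := eqVneq p (hline x u t); last first.
  by have := Q_chord_lt0 posA Sp Sz ne; rewrite pz ltxx.
by case/eqP: ori0; rewrite e /vol /hline !mxE; ring.
Qed.

(** Write r = y + b p + c p' with [y] in the span of the line. The polarity conditions give Q y y =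
    0, so [y] is a multiple of [p] and hence 0. Then 0 = Q r r = 2 b c Q p p' with Q p p' < 0, so
    [r] is a multiple of [p] or [p']. *)
Lemma tangent_points r : S r -> Q r x = 0 -> Q r u = 0 -> r = p \/ r = p'.
Proof.
move=> Sr rx ru; have [a [b [c [d rE]]]] := row_vol_basis r ori0.
have QC' := QC posA.
pose y := a *: x + d *: u.
have rE' : r = y + (b *: p + c *: p').
  by rewrite rE /y; apply/rowP => i; rewrite !mxE; ring.
have py : Q p y = 0 by rewrite /y bilDr !bilZr px pu; ring.
have ry : Q r y = 0 by rewrite /y bilDr !bilZr rx ru; ring.
have p'y : Q p' y = 0 by rewrite /y bilDr !bilZr p'x p'u; ring.
have yD : y = a *: x + d *: u by [].
clearbody y.
have yy : Q y y = 0.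
  by move: ry; rewrite rE' bilDl bilDl !bilZl py p'y !mulr0 !addr0.
have y0 : y = 0.
  have [|yE] := Q_polar_gt0 posA Sp py; first by rewrite yy ltxx.
  have k0 : - lorentz y p = 0.
    apply/eqP; move: ori0; apply: contraNT => k0.
    have pE : p = (- lorentz y p)^-1 *: y by rewrite {2}yE scalerA mulVf // scale1r.
    by rewrite pE yD /vol !mxE; apply/eqP; ring.
  by rewrite yE k0 scale0r.
rewrite y0 add0r in rE'.
have : Q r r = 0 by exact: surfQ.
rewrite {1 2}rE' bilDl !bilDr !bilZl !bilZr.
rewrite (surfQ Sp) (surfQ Sp') (QC' p' p) => e.
have qpp : Q p p' < 0 by exact: Q_chord_lt0.
have bc : b * c = 0.
  apply/eqP; have : (b * c) * Q p p' = 0 by lra.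
  by move/eqP; rewrite mulf_eq0 (lt_eqF qpp) orbF.
have col k z : S z -> r = k *: z -> r = z.
  move=> [[z1 z0] _] rz; have [[r1 r0] _] := Sr.
  have k2 : k ^+ 2 = 1 by move: r1; rewrite rz !lorentz_lin z1; lra.
  have k0 : 0 < k by move: r0; rewrite rz mxE pmulr_lgt0.
  by rewrite rz (_ : k = 1) ?scale1r //; nra.
move/eqP: bc; rewrite mulf_eq0 => /orP[]/eqP z0; rewrite z0 scale0r ?add0r ?addr0 in rE'.
  by right; exact: col rE'.
by left; exact: col rE'.
Qed.

Let L' := line_of (hline (refl p x) (- refl p u)).

(** With a the foot of the perpendicular, <a, p> = - ch d and the double angle formulas make the
    point at distance 2 d equal to [refl p] of a. The transported velocity is a constant vector
    orthogonal to [p], so [refl p] changes its sign. *)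
Lemma step_image (t : R) (v : E) X b : let d := hdist (hline x u t) p in
  frame (hline x u t) v -> lorentz v (hline u x t) = 0 ->
  p = hline (hline x u t) v d ->
  parallel_along (hline (hline x u t) v) X -> X 0 = hline u x t ->
  geodesic b -> b 0 = hline (hline x u t) v (2 * d) -> velocity b 0 = X (2 * d) ->
  line_of b = L'.
Proof.
move=> d frv va' pE parX X0 gb b0 b1.
have frt := hline_frame t fr; have [[a1 _] aa' a'a'] := frt.
have [_ av vv] := frv.
have XE : X = fun=> hline u x t.
  rewrite -X0; apply: (parallel_orth_cst frv parX).
  by rewrite X0 hline0 lorentzC.
have [_ ->] := geodesic_is_hline gb; rewrite b0 b1 XE.
rewrite /L' -(line_of_shift (refl p x) (- refl p u) (- t)) hline_refl hline_Nrefl.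
congr (line_of (hline _ _)).
  have ap : lorentz (hline x u t) p = - ch d.
    by rewrite [X in lorentz _ X]pE lorentzC lorentz_hline a1 (lorentzC v) av; ring.
  rewrite /refl ap [X in _ *: X]pE.
  rewrite (_ : 2 * d = d + d); last by ring.
  rewrite /hline chD shD; move: (ch2sh2 d) => cs.
  have ss : sh d * sh d = ch d ^+ 2 - 1 by rewrite -cs; ring.
  by rewrite ss; apply/rowP => i; rewrite !mxE; ring.
have pa' : lorentz (hline u x t) p = 0.
  by rewrite [X in lorentz _ X]pE lorentzC lorentz_hline aa' va' !mulr0 addr0.
by rewrite /refl pa' mulr0 scale0r subr0 opprK.
Qed.

Lemma step_outer : outer_lines S (line_of (hline x u)).
Proof.
split; first by exists (hline x u) => //; exact: geodesic_hline.
apply/seteqP; split=> // z [[b [t0 ->] [t <-]]] Sz; exact: out_S Sz.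
Qed.

Lemma step_graph : billiard_graph S (line_of (hline x u)) L'.
Proof.
have ou q : S q -> forall t, hline x u t != q.
  by move=> Sq t; apply/eqP => e; apply: (@out_S t); rewrite e.
split; first exact: step_outer.
have [P1 [t1 [v1 [T1 f1 o1 d1 q1]]]] := tangency_exists fr Sp px pu (ou _ Sp).
have [P2 [t2 [v2 [T2 f2 o2 d2 q2]]]] := tangency_exists fr Sp' p'x p'u (ou _ Sp').
exists (hline x u), P1, P2, p, p', t1, t2; exists (hline (hline x u t1) v1), (hline (hline x u t2) v2).
exists (fun=> v1), (fun=> v2); split=> //.
- by exists 0; apply/funext => t; rewrite addr0.
- move=> t; rewrite /positively_oriented det_rows4 velocity_hline vol_hline.
  by have := ori; rewrite (vol_feet q1 q2) pmulr_rgt0 // mulr_gt0 // sh_gt0.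
- have fr1 := hline_frame t1 fr; have [_ a1 a2] := fr1.
  set d := hdist (hline x u t1) p.
  have [Hg _ _] := hline_frame (2 * d) f1.
  have frb : frame (hline (hline x u t1) v1 (2 * d)) (hline u x t1).
    by split=> //; rewrite lorentz_hline a1 o1 !mulr0 addr0.
  exists (fun=> hline u x t1), (hline (hline (hline x u t1) v1 (2 * d)) (hline u x t1)).
  have parX : parallel_along (hline (hline x u t1) v1) (fun=> hline u x t1).
    by apply: parallel_cst; rewrite lorentzC.
  have gb := geodesic_hline frb.
  rewrite /= velocity_hline; split=> //; first by rewrite velocity_hline !hline0.
  by rewrite (step_image f1 o1 q1 parX _ gb) // ?velocity_hline hline0.
Qed.

End Step.

(** The value of [outer_billiard] is a choice from the graph, so membership of the expected line is
    not enough: every element of the graph must equal it. *)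
Lemma billiard_step (x u p p' : E) : frame x u -> S p -> S p' ->
  Q p x = 0 -> Q p u = 0 -> Q p' x = 0 -> Q p' u = 0 -> 0 < vol x p p' u ->
  outer_lines S (line_of (hline x u)) /\
  outer_billiard S (line_of (hline x u)) = line_of (hline (refl p x) (- refl p u)).
Proof.
move=> fr Sp Sp' px pu p'x p'u ori; split; first exact: step_outer ori.
have gr := step_graph fr Sp Sp' px pu p'x p'u ori.
suff uniq L' : billiard_graph S (line_of (hline x u)) L' ->
    L' = line_of (hline (refl p x) (- refl p u)).
  by apply: uniq; apply: (xgetPex set0); exists (line_of (hline (refl p x) (- refl p u))).
move=> [_ [a [P1 [P2 [p1 [p2 [t1 [t2 [g1 [g2
  [W1 [W2 [La T1 T2 orW [X [b [parX X0 gb [b0 b1] ->]]]]]]]]]]]]]]]].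
have [s aE] := line_of_hline fr La.
have fra := hline_frame s fr; rewrite aE in T1 T2 orW X0 b0 b1.
set xa := hline x u s in aE fra T1 T2 orW X0 b0 b1 *; set ua := hline u x s in aE fra T1 T2 orW X0 b0 b1 *.
have Qh q y z k : Q q y = 0 -> Q q z = 0 -> Q q (hline y z k) = 0.
  by move=> qy qz; rewrite /hline bilDr !bilZr qy qz !mulr0 addr0.
have pxa : Q p xa = 0 by exact: Qh.
have pua : Q p ua = 0 by exact: Qh.
have p'xa : Q p' xa = 0 by exact: Qh.
have p'ua : Q p' ua = 0 by exact: Qh.
have oria : 0 < vol xa p p' ua by rewrite vol_hline.
have ou q : S q -> forall t, hline xa ua t != q.
  move=> Sq t; apply/eqP => e; have [_ dis] := step_outer fra Sp pxa pua oria.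
  have : (line_points (line_of (hline xa ua)) `&` S) q.
    split=> //; exists (hline xa ua); last by exists t.
    by exists 0; apply/funext => k; rewrite addr0.
  by rewrite dis.
have Sp1 : S p1 by case: T1 => _ [].
have Sp2 : S p2 by case: T2 => _ [].
have [v1 [[_ p1x p1u] g1E W1E o1 [f1 [d1 q1]]]] := tangency_unique fra (ou _ Sp1) T1.
have [v2 [[_ p2x p2u] g2E W2E o2 [f2 [d2 q2]]]] := tangency_unique fra (ou _ Sp2) T2.
have or12 : 0 < vol xa p1 p2 ua.
  have := orW 0; rewrite /positively_oriented det_rows4 W1E W2E velocity_hline vol_hline.
  by rewrite (vol_feet q1 q2) => orv; rewrite pmulr_rgt0 // mulr_gt0 // sh_gt0.
have tp := tangent_points Sp Sp' pxa pua p'xa p'ua oria.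
(* If the first point were [p'], the volume would be 0 or negative according to the second point. *)
have p1E : p1 = p.
  case: (tp _ Sp1 p1x p1u) => // p1E.
  case: (tp _ Sp2 p2x p2u) => p2E; move: or12; rewrite p1E p2E ?vol_dup ?ltxx //.
  by rewrite vol_swap oppr_gt0 ltNge ltW.
rewrite p1E in d1 q1 b0 b1; rewrite g1E in parX b0.
rewrite velocity_hline in X0.
rewrite (step_image fra f1 o1 q1 parX X0 gb b0 b1).
rewrite -(line_of_shift (refl p x) (- refl p u) (- s)).
by rewrite hline_refl hline_Nrefl.
Qed.

End Billiard.

(** * The surface and the line *)

Section Construction.
Context {R : realType} (theta : R) (htheta : 0 < theta < pi / 2).
Local Notation E := 'rV[R]_4.

Let s5 : R := Num.sqrt 5.
Let s3 : R := Num.sqrt 3.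
(* T is the squared length of the coordinate vector transversal to the plane
   [x3 = 0]; its value solves (T - 21/8) / (T + 48) = cos theta. *)
Let T : R := (21 / 8 + 48 * cos theta) / (1 - cos theta).
Let tau : R := Num.sqrt T.
(** [D] abbreviates coordinates of the second tangency point of the first line; [nu] below
    normalises direction vectors of squared length 48 + T. *)
Let D : R := 2 * T + 9.
Let nu : R := rsqrt (48 + T).

Let s5_gt0 : 0 < s5. Proof. by rewrite sqrtr_gt0. Qed.
Let s3_gt0 : 0 < s3. Proof. by rewrite sqrtr_gt0. Qed.
Let s5_sq : s5 ^+ 2 = 5. Proof. by rewrite sqr_sqrtr. Qed.
Let s3_sq : s3 ^+ 2 = 3. Proof. by rewrite sqr_sqrtr. Qed.

Let cos_bounds : 0 < cos theta < 1.
Proof.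
have /andP[t0 t1] := htheta; have p0 := pi_gt0 R.
rewrite cos_gt0_pihalf /=; last by apply/andP; split; lra.
rewrite -cos0 ltr_cos // in_itv /=; apply/andP; split; lra.
Qed.

Let T_gt0 : 0 < T.
Proof. by have /andP[c0 c1] := cos_bounds; rewrite divr_gt0; lra. Qed.

Let tau_gt0 : 0 < tau. Proof. by rewrite sqrtr_gt0. Qed.
Let tau_sq : tau ^+ 2 = T. Proof. by rewrite sqr_sqrtr // ltW. Qed.
Let nu_gt0 : 0 < nu. Proof. exact: rsqrt_gt0. Qed.
Let nu_sq : nu ^+ 2 * (48 + T) = 1.
Proof. by apply: rsqrt_sq; have := T_gt0; lra. Qed.

(** The values of [h] and [k] are those with h s3 tau = 14 and k T = 6 T + 70, the coefficients
    wanted in the coordinates of [bary]. *)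
Let h : R := 14 / (s3 * tau).
Let k : R := (6 * T + 70) / T.

(* In the coordinates of [bary], L + A is 7 times the form
     y0^2 + y1^2 + y2^2 - 2 (y0 y1 + y1 y2 + y2 y0) + 4 z (y1 - y2) + (T + 10) z^2.
   Its first part is the Steiner inellipse of the triangle; the mixed term is
   the one for which the tangent planes at the midpoints p1, p2, p3 of the sides
   contain the lines; the last coefficient only has to be large. *)
Definition billiard_form : 'M[R]_4 := \matrix_(i < 4, j < 4)
  nth 0 (nth [::] [:: [:: 8 / 15; 0; 0; 0]; [:: 0; 4 / 3; 0; 0];
    [:: 0; 0; 4 / 3; h]; [:: 0; 0; h; k]] i) j.
Local Notation A := billiard_form.

(* y0, y1, y2 are coordinates with respect to the vertices of an equilateral
   triangle with cosh (side) = 7 in the plane x3 = 0. *)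
Definition bary (y0 y1 y2 z : R) : E :=
  mk4 (s5 * (y0 + y1 + y2)) (2 * y0 - y1 - y2) (s3 * (y1 - y2)) (tau * z).

Lemma baryZ a y0 y1 y2 z : a *: bary y0 y1 y2 z = bary (a * y0) (a * y1) (a * y2) (a * z).
Proof. by apply: row4P; rewrite mxE !mk4E; ring. Qed.

Lemma baryD y0 y1 y2 z w0 w1 w2 w :
  bary y0 y1 y2 z + bary w0 w1 w2 w = bary (y0 + w0) (y1 + w1) (y2 + w2) (z + w).
Proof. by apply: row4P; rewrite mxE !mk4E; ring. Qed.

(** The vertices have Lorentz square -1 and pairwise products -7; the transversal vector is
    orthogonal to them with square T. *)
Lemma lorentz_bary y0 y1 y2 z w0 w1 w2 w :
  lorentz (bary y0 y1 y2 z) (bary w0 w1 w2 w) =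
  6 * (y0 * w0 + y1 * w1 + y2 * w2) - 7 * (y0 + y1 + y2) * (w0 + w1 + w2) + T * z * w.
Proof.
rewrite lorentzE !mk4E.
apply: (@eq_trans _ _ (- (s5 ^+ 2) * ((y0 + y1 + y2) * (w0 + w1 + w2))
  + (2 * y0 - y1 - y2) * (2 * w0 - w1 - w2)
  + s3 ^+ 2 * ((y1 - y2) * (w1 - w2)) + tau ^+ 2 * (z * w))); first by ring.
by rewrite s5_sq s3_sq tau_sq; ring.
Qed.

Lemma billiard_formE x y : bil A x y = 8 / 15 * (x 0 k0 * y 0 k0)
  + 4 / 3 * (x 0 k1 * y 0 k1) + 4 / 3 * (x 0 k2 * y 0 k2)
  + h * (x 0 k2 * y 0 k3 + x 0 k3 * y 0 k2) + k * (x 0 k3 * y 0 k3).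
Proof. by rewrite /bil !sum4 !mxE /=; ring. Qed.

Lemma form_bary y0 y1 y2 z w0 w1 w2 w :
  bil A (bary y0 y1 y2 z) (bary w0 w1 w2 w) =
  8 * (y0 * w0 + y1 * w1 + y2 * w2) + 14 * (z * (w1 - w2) + w * (y1 - y2))
  + (6 * T + 70) * z * w.
Proof.
have t0 := lt0r_neq0 tau_gt0; have s0 := lt0r_neq0 s3_gt0; have T0 := lt0r_neq0 T_gt0.
have hE : h * s3 * tau = 14 by rewrite /h -mulrA divfK // mulf_neq0.
have kE : k * T = 6 * T + 70 by rewrite /k divfK.
rewrite billiard_formE !mk4E.
apply: (@eq_trans _ _ (8 / 15 * s5 ^+ 2 * ((y0 + y1 + y2) * (w0 + w1 + w2))
  + 4 / 3 * ((2 * y0 - y1 - y2) * (2 * w0 - w1 - w2))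
  + 4 / 3 * s3 ^+ 2 * ((y1 - y2) * (w1 - w2))
  + (h * s3 * tau) * (z * (w1 - w2) + w * (y1 - y2))
  + (k * tau ^+ 2) * (z * w))); first by ring.
by rewrite s5_sq s3_sq tau_sq hE kE; field.
Qed.

(** The change of coordinates has positive determinant, so orientations can be read off in the
    coordinates of [bary]. *)
Lemma vol_bary x0 x1 x2 x3 y0 y1 y2 y3 z0 z1 z2 z3 w0 w1 w2 w3 :
  vol (bary x0 x1 x2 x3) (bary y0 y1 y2 y3) (bary z0 z1 z2 z3) (bary w0 w1 w2 w3)
  = 6 * s5 * s3 * tau * vol (mk4 x0 x1 x2 x3) (mk4 y0 y1 y2 y3) (mk4 z0 z1 z2 z3)
      (mk4 w0 w1 w2 w3).
Proof. by rewrite /vol !mk4E; ring. Qed.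

Lemma billiard_form_pos : posform A.
Proof.
have T0 := T_gt0; have t0 := lt0r_neq0 tau_gt0; have s0 := lt0r_neq0 s3_gt0.
have Tn := lt0r_neq0 T_gt0.
have h2 : h ^+ 2 = 196 / (3 * T).
  rewrite /h expr_div_n exprMn s3_sq tau_sq; congr (_ / _); ring.
(* The coefficient of x3^2 left after completing the square in x2. *)
pose r := (6 * T + 21) / T; have r0 : 0 < r by rewrite divr_gt0 //; lra.
have kr : k = r + 3 / 4 * h ^+ 2 by rewrite h2 /k /r; field.
have EA (x : E) : bil A x x = 8 / 15 * x 0 k0 ^+ 2 + 4 / 3 * x 0 k1 ^+ 2
    + 4 / 3 * (x 0 k2 + 3 / 4 * h * x 0 k3) ^+ 2 + r * x 0 k3 ^+ 2.
  by rewrite billiard_formE kr; field.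
have sq (x : E) : [/\ 0 <= x 0 k0 ^+ 2, 0 <= x 0 k1 ^+ 2,
    0 <= (x 0 k2 + 3 / 4 * h * x 0 k3) ^+ 2 & 0 <= r * x 0 k3 ^+ 2].
  by rewrite !sqr_ge0 mulr_ge0 ?sqr_ge0 // ltW.
split.
- by apply/matrixP; apply: ord4P; apply: ord4P; rewrite !mxE.
- move=> x xn; rewrite ltNge; apply: contra_neqN xn => le0.
  have [a b c d] := sq x; rewrite EA in le0.
  have z0 : x 0 k0 = 0 by apply/eqP; rewrite -sqrf_eq0; apply/eqP; lra.
  have z1 : x 0 k1 = 0 by apply/eqP; rewrite -sqrf_eq0; apply/eqP; lra.
  have z3 : x 0 k3 = 0.
    apply/eqP; rewrite -sqrf_eq0 -[_ == _]orFb -(gt_eqF r0) -mulf_eq0.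
    by apply/eqP; lra.
  have z2 : x 0 k2 = 0.
    apply/eqP; rewrite -sqrf_eq0; apply/eqP; move: c le0; rewrite z3 mulr0 addr0; lra.
  by apply: row4P; rewrite !mxE.
- exists (8 / 15); first by lra.
  by move=> x; have [_ b c d] := sq x; rewrite EA; lra.
Qed.

Lemma billiard_form_e0 : bil A e0 e0 < 1.
Proof. by rewrite billiard_formE !mxE /=; lra. Qed.

Local Notation S := (surf A).
Local Notation Q := (bil (Qm A)).

Lemma Q_bary y0 y1 y2 z w0 w1 w2 w : Q (bary y0 y1 y2 z) (bary w0 w1 w2 w) =
  7 * (2 * (y0 * w0 + y1 * w1 + y2 * w2) - (y0 + y1 + y2) * (w0 + w1 + w2)
  + 2 * (z * (w1 - w2) + w * (y1 - y2)) + (T + 10) * z * w).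
Proof. by rewrite QE lorentz_bary form_bary; ring. Qed.

Lemma H3_bary y0 y1 y2 z : 0 < y0 + y1 + y2 ->
  6 * (y0 ^+ 2 + y1 ^+ 2 + y2 ^+ 2) - 7 * (y0 + y1 + y2) ^+ 2 + T * z ^+ 2 = -1 ->
  H3 (bary y0 y1 y2 z).
Proof.
move=> y_gt0 e; split; first by rewrite lorentz_bary -[RHS]e; ring.
by rewrite mk4E mulr_gt0.
Qed.

(** The triangle and its midpoints; the factor 1/4 normalises o0 + o1, whose Lorentz square is
    -16. *)
Let o0 := bary 1 0 0 0.
Let o1 := bary 0 1 0 0.
Let o2 := bary 0 0 1 0.
Let p1 := bary (1 / 4) (1 / 4) 0 0.
Let p2 := bary 0 (1 / 4) (1 / 4) 0.
Let p3 := bary (1 / 4) 0 (1 / 4) 0.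
(* The second tangency point of the first line, by Vieta's formula. *)
Let w := bary (8 * D + 33) 33 (8 * D) (- 24).
Let rho := rsqrt (- lorentz w w).
Let p0 := rho *: w.
(** Directions of the successive lines at [o0], [o1], [o2] and again [o0]; each is minus the
    reflection of the previous one in [p1], [p2], [p3]. *)
Let u0 := nu *: bary (21 / 4) (- 7 / 4) 1 1.
Let u1 := nu *: bary 0 (- 7) 1 1.
Let u2 := nu *: bary 0 (- 1) 7 1.
Let u3 := nu *: bary (- 21 / 4) (- 1) (7 / 4) 1.

Let o0_H3 : H3 o0. Proof. by apply: H3_bary; lra. Qed.
Let o1_H3 : H3 o1. Proof. by apply: H3_bary; lra. Qed.
Let o2_H3 : H3 o2. Proof. by apply: H3_bary; lra. Qed.

Let Sp1 : S p1.
Proof. by split; [apply: H3_bary|rewrite form_bary]; lra. Qed.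
Let Sp2 : S p2.
Proof. by split; [apply: H3_bary|rewrite form_bary]; lra. Qed.
Let Sp3 : S p3.
Proof. by split; [apply: H3_bary|rewrite form_bary]; lra. Qed.

Let D_gt0 : 0 < D. Proof. by have := T_gt0; rewrite /D; lra. Qed.

Let Sp0 : S p0.
Proof.
have Qw : Q w w = 0 by rewrite Q_bary /D; ring.
have w0 : 0 < w 0 k0.
  by rewrite /w mk4E mulr_gt0 //; have := D_gt0; lra.
have wn : w != 0 by apply/eqP => e; move: w0; rewrite e mxE ltxx.
apply: Qsurf; last by rewrite bilZl bilZr Qw !mulr0.
apply: H3_rescale => //.
by move: Qw; rewrite QE; have [_ /(_ _ wn) + _] := billiard_form_pos; lra.
Qed.

Let nu_frame x v : H3 x -> lorentz x v = 0 -> lorentz v v = 48 + T ->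
  frame x (nu *: v).
Proof.
move=> Hx xv vv; split; rewrite ?lorentzZr ?lorentzZl ?xv ?mulr0 // vv.
by rewrite mulrA -expr2.
Qed.

Let fr0 : frame o0 u0.
Proof. by apply: nu_frame => //; rewrite lorentz_bary; field. Qed.
Let fr1 : frame o1 u1.
Proof. by apply: nu_frame => //; rewrite lorentz_bary; field. Qed.
Let fr2 : frame o2 u2.
Proof. by apply: nu_frame => //; rewrite lorentz_bary; field. Qed.

Let step0 : outer_lines S (line_of (hline o0 u0)) /\
  outer_billiard S (line_of (hline o0 u0)) = line_of (hline o1 u1).
Proof.
have -> : o1 = refl p1 o0.
  by rewrite /refl -scaleN1r -scaleNr lorentz_bary !baryZ baryD; congr bary; field.
have -> : u1 = - refl p1 u0.
  by rewrite /refl opprB opprK /u0 /u1 lorentzZl lorentz_bary !baryZ baryD; congr bary; field.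
apply: (billiard_step billiard_form_pos billiard_form_e0 fr0 Sp1 Sp0).
- by rewrite Q_bary; field.
- by rewrite bilZr Q_bary; field.
- by rewrite bilZl Q_bary; field.
- by rewrite bilZl bilZr Q_bary /D; field.
- rewrite /p0 /u0 !baryZ vol_bary /vol !mk4E.
  rewrite pmulr_rgt0 ?mulr_gt0 //.
  have := mulr_gt0 (rsqrt_gt0 (- lorentz w w)) nu_gt0; rewrite -/rho => rn.
  rewrite [X in 0 < X](_ : _ = rho * nu * (2 * D + 6)); last by field.
  by rewrite mulr_gt0 //; have := D_gt0; lra.
Qed.

(** The + tangency point [p1] of the first line is the - tangency point of its image, and likewise
    at the next step, so only [p0] has to be computed separately. *)
Let step1 : outer_lines S (line_of (hline o1 u1)) /\
  outer_billiard S (line_of (hline o1 u1)) = line_of (hline o2 u2).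
Proof.
have -> : o2 = refl p2 o1.
  by rewrite /refl -scaleN1r -scaleNr lorentz_bary !baryZ baryD; congr bary; field.
have -> : u2 = - refl p2 u1.
  by rewrite /refl opprB opprK /u1 /u2 lorentzZl lorentz_bary !baryZ baryD; congr bary; field.
apply: (billiard_step billiard_form_pos billiard_form_e0 fr1 Sp2 Sp1).
- by rewrite Q_bary; field.
- by rewrite bilZr Q_bary; field.
- by rewrite Q_bary; field.
- by rewrite bilZr Q_bary; field.
- rewrite /u1 !baryZ vol_bary /vol !mk4E.
  by rewrite pmulr_rgt0 ?mulr_gt0 //; have := nu_gt0; lra.
Qed.

Let step2 : outer_lines S (line_of (hline o2 u2)) /\
  outer_billiard S (line_of (hline o2 u2)) = line_of (hline o0 u3).
Proof.
have -> : o0 = refl p3 o2.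
  by rewrite /refl -scaleN1r -scaleNr lorentz_bary !baryZ baryD; congr bary; field.
have -> : u3 = - refl p3 u2.
  by rewrite /refl opprB opprK /u2 /u3 lorentzZl lorentz_bary !baryZ baryD; congr bary; field.
apply: (billiard_step billiard_form_pos billiard_form_e0 fr2 Sp3 Sp2).
- by rewrite Q_bary; field.
- by rewrite bilZr Q_bary; field.
- by rewrite Q_bary; field.
- by rewrite bilZr Q_bary; field.
- rewrite /u2 !baryZ vol_bary /vol !mk4E.
  by rewrite pmulr_rgt0 ?mulr_gt0 //; have := nu_gt0; lra.
Qed.

Lemma billiard_example : exists L : set (R -> E),
  [/\ closed_surface S, quadratically_convex S, outer_lines S L
    & meet_at_angle L (iter 3 (outer_billiard S) L) theta].
Proof.
have [out0 e1] := step0; have [_ e2] := step1; have [_ e3] := step2.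
exists (line_of (hline o0 u0)); split=> //.
- exact: surf_closed_surface billiard_form_pos billiard_form_e0.
- exact: surf_convex billiard_form_pos billiard_form_e0.
rewrite /= e1 e2 e3.
exists (hline o0 u0), (hline o0 u3), 0, 0; split.
- by exists 0; apply/funext => t; rewrite addr0.
- by exists 0; apply/funext => t; rewrite addr0.
- by rewrite !hline0.
have vv3 : lorentz u3 u3 = 1.
  by rewrite lorentzZl lorentzZr lorentz_bary -[RHS]nu_sq; field.
have [_ _ vv0] := fr0.
have v0 : velocity (hline o0 u0) 0 = u0 by rewrite velocity_hline hline0.
have v3 : velocity (hline o0 u3) 0 = u3 by rewrite velocity_hline hline0.
rewrite v0 v3 /hangle vv0 vv3 sqrtr1 mulr1 divr1.
have /andP[c0 c1] := cos_bounds.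
(* The product is (T - 21/8) / (T + 48), and [T] was chosen to make it cos theta. *)
have -> : lorentz u0 u3 = cos theta.
  rewrite lorentzZl lorentzZr lorentz_bary.
  apply: (@eq_trans _ _ (nu ^+ 2 * (T - 21 / 8))); first by field.
  have -> : T - 21 / 8 = cos theta * (48 + T).
    have Te : T * (1 - cos theta) = 21 / 8 + 48 * cos theta.
      by rewrite /T divfK //; apply: lt0r_neq0; lra.
    by lra.
  by rewrite mulrCA nu_sq mulr1.
rewrite cosK // in_itv /=.
by have /andP[t0 t1] := htheta; have := pi_gt0 R; move=> ?; apply/andP; split; lra.
Qed.

End Construction.

Theorem proposition1p8 (R : realType) (theta : R)
    (htheta : 0 < theta < pi / 2) :
  exists (S : set 'rV[R]_4) (L : set (R -> 'rV[R]_4)),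
    [/\ closed_surface S,
        quadratically_convex S,
        outer_lines S L
      & meet_at_angle L (iter 3 (outer_billiard S) L) theta].
Proof. by exists (surf (billiard_form theta)); exact: billiard_example. Qed.
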